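(* Suppose that $g(r) = o(r^{-c})$ as $r \to \infty$ for some $c > d$. Let $b \in \mathbb{R}$ and define $r_n(b)$ by $r_n(b)^d = \frac{\log n + b}{\alpha n}$ (for all $n$ large enough that the right-hand side is positive). Let $W_n(r)$ be the number of isolated nodes (vertices of degree zero) in the graph $G_n(r)$. Then $E[W_n(r_n(b))] \to e^{-b}$ as $n \to \infty$.
   Context: Let $d \ge 2$ and $S = \left(-\frac12,\frac12\right]^d$, equipped with the toroidal metric $d(x,y) = \inf\{|x-y-z| : z \in \mathbb{Z}^d\}$, where $|\cdot|$ is the Euclidean norm. (The letter $d$ denotes the dimension; $d(\cdot,\cdot)$ denotes the metric.) The connection function $g:[0,\infty)\to[0,1]$ is non-increasing with $0 < \alpha := \int_{\mathbb{R}^d} g(|x|)\,dx < \infty$. On one probability space $(\Omega,\mathcal{F},P)$ let $X_1,X_2,\ldots$ be independent and uniformly distributed on $S$; let $\{N_n\}_{n\ge1}$ be a non-decreasing sequence of random variables with $N_n$ Poisson of mean $n$; and let $\{U_{ij}\}$ be independent uniform random variables on $[0,1]$; these three families are independent of each other. Set $\mathcal{P}_n = \{X_1,\ldots,X_{N_n}\}$, a Poisson point process of intensity $n$ on $S$. For $r>0$, $G_n(r)$ is the (undirected) graph with vertex set $\mathcal{P}_n$ in which $X_i,X_j\in\mathcal{P}_n$, $i<j$, are joined by an edge iff $U_{ij} \le g\left(\frac{d(X_i,X_j)}{r}\right)$. *)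

(* Defs.v *)
From HB Require Import structures.
From mathcomp Require Import all_boot all_order all_algebra finmap.
From mathcomp Require Import all_classical all_reals all_analysis.

Set Implicit Arguments.
Unset Strict Implicit.
Unset Printing Implicit Defensive.

Import Order.TTheory GRing.Theory Num.Theory.
Import numFieldNormedType.Exports.

Local Open Scope classical_set_scope.
Local Open Scope ring_scope.

(** Points of [R^n] are encoded as [n.-tuple R], whose sigma-algebra is generated
    by the coordinates.  [lebesgue_tuple n] is Lebesgue measure on [R^n], obtained
    from the binary product measure by recursion on [n]; [lebesgue_tuple_box]
    gives its value on boxes. *)

Section lebesgue_cons.
Context {R : realType} (n : nat).

Definition cons_pair (p : measurableTypeR R * n.-tuple R) : n.+1.-tuple R :=
  [tuple of p.1 :: p.2].

Lemma measurable_cons_pair : measurable_fun setT cons_pair.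
Proof. exact: (measurable_cons measurable_fst measurable_snd). Qed.

Variable mu : {sigma_finite_measure set (n.-tuple R) -> \bar R}.

Definition lebesgue_cons : set (n.+1.-tuple R) -> \bar R :=
  pushforward (lebesgue_measure \x mu)%E cons_pair.

Let lebesgue_cons0 : lebesgue_cons set0 = 0%E.
Proof. by rewrite /lebesgue_cons /pushforward preimage_set0 measure0. Qed.

Let lebesgue_cons_ge0 A : (0 <= lebesgue_cons A)%E.
Proof. by rewrite /lebesgue_cons /pushforward measure_ge0. Qed.

Let lebesgue_cons_sigma_additive : semi_sigma_additive lebesgue_cons.
Proof.
move=> F mF tF mUF; rewrite /lebesgue_cons /pushforward preimage_bigcup.
apply: measure_semi_sigma_additive.
- by move=> k; rewrite -[X in measurable X]setTI; exact: measurable_cons_pair.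
- apply/trivIsetP => /= i j _ _ ij; rewrite -preimage_setI.
  by move/trivIsetP : tF => /(_ _ _ _ _ ij) ->//; rewrite preimage_set0.
- rewrite -preimage_bigcup -[X in measurable X]setTI.
  exact: measurable_cons_pair.
Qed.

HB.instance Definition _ := isMeasure.Build _ _ _ lebesgue_cons
  lebesgue_cons0 lebesgue_cons_ge0 lebesgue_cons_sigma_additive.

Lemma lebesgue_cons_sigma_finite : sigma_finite setT lebesgue_cons.
Proof.
have /sigma_finiteP[F [TF ndF Foo]] := sigma_finiteT (@lebesgue_measure R).
have /sigma_finiteP[G [TG ndG Goo]] := sigma_finiteT mu.
pose uncons (t : n.+1.-tuple R) : measurableTypeR R * n.-tuple R :=
  (thead t, [tuple of behead t]).
have muncons : measurable_fun setT uncons.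
  apply: measurable_fun_pair; last exact: measurable_behead.
  exact: measurable_tnth.
exists (fun k => uncons @^-1` (F k `*` G k)).
  apply/esym; rewrite -subTset => t _.
  have [i _ Fi] : (\bigcup_k F k) (uncons t).1 by rewrite -TF.
  have [j _ Gj] : (\bigcup_k G k) (uncons t).2 by rewrite -TG.
  exists (maxn i j) => //; split.
    by move: Fi; exact/subsetPset/ndF/leq_maxl.
  by move: Gj; exact/subsetPset/ndG/leq_maxr.
move=> k; have [mF finF] := Foo k; have [mG finG] := Goo k.
have mFG : measurable (F k `*` G k) by exact: measurableX.
split; first by rewrite -[X in measurable X]setTI; exact: muncons.
rewrite /lebesgue_cons /pushforward -comp_preimage (_ : _ \o _ = id).
  by rewrite /= product_measure1E// lte_mul_pinfty// ge0_fin_numE.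
by apply/funext => -[x t] /=; congr pair; exact/val_inj.
Qed.

HB.instance Definition _ :=
  Measure_isSigmaFinite.Build _ _ _ lebesgue_cons lebesgue_cons_sigma_finite.

End lebesgue_cons.

Fixpoint lebesgue_tuple {R : realType} (n : nat) :
    {sigma_finite_measure set (n.-tuple R) -> \bar R} :=
  match n with
  | 0 => \d_([tuple] : 0.-tuple R)
  | m.+1 => lebesgue_cons (lebesgue_tuple m)
  end.

Lemma lebesgue_tuple_box {R : realType} (n : nat)
    (A : 'I_n -> set R) (mA : forall i, measurable (A i)) :
  (lebesgue_tuple n [set x | forall i, A i (tnth x i)] =
   \prod_(i < n) lebesgue_measure (A i))%E.
Proof.
elim: n A mA => [|n IHn] A mA.
  rewrite big_ord0 /= diracE mem_set//; by case.
rewrite big_ord_recl /= /lebesgue_cons /pushforward.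
rewrite (_ : _ @^-1` _ = A ord0 `*`
    [set x : n.-tuple R | forall i, A (lift ord0 i) (tnth x i)]); last first.
  apply/seteqP; split => -[x t] /=.
    move=> h; split; first exact: (h ord0).
    by move=> i; have := h (lift ord0 i); rewrite tnthS.
  by move=> [h0 hS] i; case: (unliftP ord0 i) => [j ->|->]; rewrite ?tnthS.
rewrite product_measure1E; [|exact: mA|]; last first.
  rewrite (_ : [set _ | _] =
      \bigcap_(i in [set: 'I_n]) (@tnth n R ^~ i @^-1` A (lift ord0 i))).
    apply: fin_bigcap_measurable => // i _.
    by rewrite -[X in measurable X]setTI; exact: measurable_tnth.
  by apply/seteqP; split => x /= h i; [move=> _|]; exact: h.
by congr (_ * _)%E; exact: (IHn (fun i => A (lift ord0 i))).
Qed.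

Definition euclid_norm {R : realType} (n : nat) (x : n.-tuple R) : R :=
  Num.sqrt (\sum_(i < n) tnth x i ^+ 2).

Definition torus {R : realType} (n : nat) : set (n.-tuple R) :=
  [set x | forall i, - 2^-1 < tnth x i <= 2^-1].
Arguments torus {R} n _.

Definition torus_dist {R : realType} (n : nat) (x y : n.-tuple R) : R :=
  inf [set euclid_norm [tuple tnth x i - tnth y i - (z i)%:~R | i < n]
      | z in [set: 'I_n -> int]].

Lemma lebesgue_torus {R : realType} (n : nat) :
  lebesgue_tuple n (torus n) = 1%E :> \bar R.
Proof.
rewrite (_ : torus n = [set x : n.-tuple R | forall i, `]- 2^-1, 2^-1]%classic (tnth x i)]);
  last by apply/seteqP; split => x /= h i; have := h i; rewrite in_itv.
rewrite (lebesgue_tuple_box (A := fun=> _))// big1// => i _.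
rewrite lebesgue_measure_itv/= lte_fin ifT; last first.
  by rewrite -subr_gt0 opprK addr_gt0// invr_gt0.
by rewrite -EFinD opprK -[X in X + _]mul1r -[X in _ + X]mul1r -splitr.
Qed.

(** Needed by the notation [f =o_ (pinfty_nbhs R) h]. *)
Canonical pinfty_filter_on (R : realType) : filter_on R :=
  FilterType (pinfty_nbhs R) (@filter_filter _ _ proper_pinfty_nbhs).

Section probability_notions.
Context {d : measure_display} {T : measurableType d} {R : realType}.
Variable P : probability T R.

Definition mutually_independent {I : choiceType} (A : set I)
    (F : I -> set_system T) : Prop :=
  forall (J : {fset I}) (E : I -> set T),
    [set` J] `<=` A -> (forall i, i \in J -> F i (E i)) ->
  P (\bigcap_(i in [set` J]) E i) = (\prod_(i <- J) P (E i))%E.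

Definition sigma_of {d' : measure_display} {T' : measurableType d'}
    (X : {RV P >-> T'}) : set_system T :=
  preimage_set_system setT X measurable.

Definition sigma_of_family {I : Type} (A : set I)
    {d' : measure_display} {T' : measurableType d'}
    (X : I -> {RV P >-> T'}) : set_system T :=
  <<s \bigcup_(i in A) sigma_of (X i) >>.

Definition independent_family {I : choiceType} (A : set I)
    {d' : measure_display} {T' : measurableType d'}
    (X : I -> {RV P >-> T'}) : Prop :=
  mutually_independent A (fun i => sigma_of (X i)).

Definition has_law {d' : measure_display} {T' : measurableType d'}
    (X : {RV P >-> T'}) (nu : set T' -> \bar R) : Prop :=
  forall B, measurable B -> distribution P X B = nu B.

End probability_notions.

Section random_connection_model.
Context {R : realType} {T : Type} (n : nat).
Variables (g : R -> R) (X : nat -> T -> n.-tuple R) (U : nat -> nat -> T -> R).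

Definition connected (r : R) (w : T) (i j : nat) : bool :=
  U i j w <= g (torus_dist (X i w) (X j w) / r).

(** Only the variables [U i j] with [i < j] are used; the edges are undirected
    and there are no loops. *)
Definition edge (r : R) (w : T) (i j : nat) : bool :=
  (i < j)%N && connected r w i j || (j < i)%N && connected r w j i.

Variable N : T -> nat.

(** A vertex is represented by its index [i < N w], i.e. the points are numbered
    from [0]; almost surely distinct indices give distinct points. *)
Definition degree (r : R) (w : T) (i : 'I_(N w)) : nat :=
  #|[pred j : 'I_(N w) | edge r w i j]|.

Definition isolated_nodes (r : R) (w : T) : nat :=
  #|[pred i : 'I_(N w) | degree r i == 0%N]|.

End random_connection_model.

(* Main.v *)
Require Import Defs.
From mathcomp Require Import all_boot all_order all_algebra finmap.
From mathcomp Require Import all_classical all_reals all_analysis.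
From mathcomp Require Import measurable_realfun.
From mathcomp Require Import ring lra.

Set Implicit Arguments.
Unset Strict Implicit.
Unset Printing Implicit Defensive.

Import Order.TTheory GRing.Theory Num.Theory.
Import numFieldNormedType.Exports.

Local Open Scope classical_set_scope.
Local Open Scope ring_scope.

(** Fix [n] and [r], and let [q] be the integral over the torus [S] of
    [g (d(x, y) / r)] with respect to [y], that is the probability that a vertex
    at [x] is joined to a uniform one.  Translations of the torus preserve
    Lebesgue measure, so [q] does not depend on [x] ([integral_torus_dist]).
    Hence, among [m] vertices, each one is isolated with probability
    [(1 - q) ^+ m.-1]: given its position, its [m - 1] potential edges are
    absent independently of each other ([measure_star_constraints],
    [prob_all_unlinked]).  Averaging [m * (1 - q) ^+ m.-1] over the Poisson
    number of vertices gives the exact value [n * expR (- (n * q))] of the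
    expectation ([expectation_isolated]).

    It remains to see that [n * q = ln n + b + o(1)] when [r = r n].  On [S] the
    distance to the origin is the Euclidean norm, so rescaling by [r] yields
    [q = r ^+ d * (alpha - tau)], where [tau] is the integral of [g(|u|)]
    outside the cube of half-side [(2 * r)^-1]; and [n * r ^+ d * alpha] is
    [ln n + b] by the choice of [r].  The error [(ln n + b) * tau / alpha] is a
    product of a divergent factor and a vanishing one, so integrability of
    [g(|u|)] alone does not control it: this is where the decay of [g] enters.
    It implies [tau = O(r `^ (c - d))] ([integral_tail_le],
    [connection_mass_bounds]), and [r] is smaller than a negative power of [n],
    which beats the logarithm ([cvg_isolated_limit]). *)

(** * Affine changes of variable on the line *)

Section image_measure.
Context {d1 d2 : measure_display} {T1 : measurableType d1}
  {T2 : measurableType d2} {R : realType}.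
Variables (m : {measure set T1 -> \bar R}) (f : T1 -> T2).

(** The structure of measure on a pushforward depends on the measurability
    proof; taking that proof as an argument makes it available to unification. *)
Definition image_measure (mf : measurable_fun setT f) :
  {measure set T2 -> \bar R}.
Proof. by refine (pushforward m f : {measure set T2 -> \bar R}). Defined.

Lemma ge0_integral_image_measure mf (h : T2 -> \bar R) :
  measurable_fun setT h -> (forall y, 0 <= h y)%E ->
  (\int[image_measure mf]_y h y = \int[m]_x h (f x))%E.
Proof.
move=> mh h0; rewrite -[RHS]/(\int[m]_(x in f @^-1` setT) (h \o f) x)%E.
by rewrite -ge0_integral_pushforward.
Qed.
End image_measure.

Section one_dim.
Context {R : realType}.
Local Notation mu := (@lebesgue_measure R).

Lemma measurable_affine (a s : R) :
  measurable_fun setT ((fun y => a + s * y) : measurableTypeR R -> measurableTypeR R).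
Proof. by apply: measurable_funD => //; apply: measurable_funM. Qed.

(** Both sides give the interval [u, v] the same length, and a measure on the
    line is determined by its values on intervals. *)
Lemma lebesgue_measure_affine (a s : R) (s0 : 0 < s) A : measurable A ->
  mu A = mscale (NngNum (ltW s0)) (image_measure mu (measurable_affine a s)) A.
Proof.
move=> mA; apply: lebesgue_measure_unique => // X [/= [u v] _ <-].
rewrite /mscale /= /pushforward /=.
rewrite (_ : _ @^-1` _ = `](u - a) / s, (v - a) / s]%classic); last first.
  apply/seteqP; split => y /=; rewrite !in_itv /= ltr_pdivrMr// ler_pdivlMr//.
    by move=> /andP[? ?]; apply/andP; split; nra.
  by move=> /andP[? ?]; apply/andP; split; nra.
rewrite !lebesgue_measure_itv /= !lte_fin ltr_pM2r ?invr_gt0// ltrD2r.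
case: ifPn => _; last by rewrite mule0.
rewrite -!EFinD -EFinM; congr EFin; field.
by rewrite gt_eqF.
Qed.

Lemma ge0_integral_affine (a s : R) (f : R -> \bar R) : 0 < s ->
  measurable_fun setT f -> (forall x, 0 <= f x)%E ->
  (\int[mu]_y f y = s%:E * \int[mu]_y f (a + s * y)%R)%E.
Proof.
move=> s0 mf f0.
rewrite (eq_measure_integral _ (fun A mA _ => lebesgue_measure_affine a s0 mA)).
by rewrite ge0_integral_mscale// ge0_integral_image_measure.
Qed.
End one_dim.

(** * Coordinatewise changes of variable in dimension n *)

Section tuple_integral.
Context {R : realType}.
Local Notation mu := (@lebesgue_measure R).
Local Open Scope ereal_scope.

(** Tonelli's theorem for the recursive definition of [lebesgue_tuple]. *)
Lemma ge0_integral_lebesgue_tupleS n (G : n.+1.-tuple R -> \bar R) :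
  measurable_fun setT G -> (forall x, 0 <= G x) ->
  \int[lebesgue_tuple n.+1]_x G x =
  \int[mu]_a \int[lebesgue_tuple n]_t G [tuple of a :: t].
Proof.
move=> mG G0.
rewrite -[LHS]/(\int[pushforward (mu \x lebesgue_tuple n) (@cons_pair R n)]_x G x).
rewrite ge0_integral_pushforward//; last exact: measurable_cons_pair.
rewrite preimage_setT fubini_tonelli1//.
  by apply: measurableT_comp => //; exact: measurable_cons_pair.
by move=> ?; exact: G0.
Qed.

Definition cube n (D : set R) : set (n.-tuple R) := [set x | forall i, D (tnth x i)].

Lemma measurable_cube n (D : set R) : measurable D -> measurable (@cube n D).
Proof.
move=> mD; rewrite (_ : @cube n D = \bigcap_(i in [set: 'I_n]) (@tnth n R ^~ i @^-1` D)).
  apply: fin_bigcap_measurable => // i _.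
  by rewrite -[X in measurable X]setTI; exact: measurable_tnth.
by apply/seteqP; split => x /= h i; [move=> _|]; exact: h.
Qed.

Lemma cube_cons n (D : set R) a (t : n.-tuple R) :
  cube D [tuple of a :: t] <-> D a /\ cube D t.
Proof.
split => [h|[Da Dt] i].
  by split=> [|i]; [exact: (h ord0)|have := h (lift ord0 i); rewrite tnthS].
by case: (unliftP ord0 i) => [j ->|->]; rewrite ?tnthS//; exact: Dt.
Qed.

Lemma ge0_integral_cubeS n (D : set R) (G : n.+1.-tuple R -> \bar R) :
  measurable D -> measurable_fun setT G -> (forall x, 0 <= G x) ->
  \int[lebesgue_tuple n.+1]_(x in cube D) G x =
  \int[mu]_(a in D) \int[lebesgue_tuple n]_(t in cube D) G [tuple of a :: t].
Proof.
move=> mD mG G0.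
rewrite integral_mkcond/= ge0_integral_lebesgue_tupleS//=; last 2 first.
- apply/(measurable_restrictT _ (measurable_cube mD)).
  exact: measurable_funTS.
- by move=> x; apply: erestrict_ge0.
rewrite [RHS]integral_mkcond/=; apply: eq_integral => a _.
rewrite [RHS]patchE; case: ifPn => Da.
  rewrite [RHS]integral_mkcond; apply: eq_integral => t _.
  rewrite !patchE; congr (if _ then _ else _).
  apply/idP/idP; rewrite !inE => h; first by case/cube_cons : h.
  by apply/cube_cons; split => //; exact: set_mem.
apply: integral0_eq => t _; rewrite patchE ifF//.
apply/negbTE; apply: contra Da; rewrite !inE.
by case/cube_cons.
Qed.

Definition map_coord n (phi : 'I_n -> R -> R) (x : n.-tuple R) : n.-tuple R :=
  [tuple phi i (tnth x i) | i < n].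

Lemma map_coord_cons n (phi : 'I_n.+1 -> R -> R) a (t : n.-tuple R) :
  map_coord phi [tuple of a :: t] =
  [tuple of phi ord0 a :: map_coord (fun i => phi (lift ord0 i)) t].
Proof.
apply: eq_from_tnth => i; rewrite tnth_mktuple.
by case: (unliftP ord0 i) => [j ->|->]; rewrite ?tnthS ?tnth_mktuple.
Qed.

Lemma measurable_map_coord n (phi : 'I_n -> R -> R) :
  (forall i, measurable_fun setT (phi i)) -> measurable_fun setT (map_coord phi).
Proof.
move=> mphi; apply/measurable_fun_tnthP => i.
apply: (eq_measurable_fun (fun x => phi i (tnth x i))).
  by move=> x _ /=; rewrite tnth_mktuple.
by apply: measurableT_comp => //; exact: measurable_tnth.
Qed.

Lemma measurable_integral_cube n (D : set R) (h : n.-tuple R -> n.-tuple R)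
    (F : n.+1.-tuple R -> \bar R) :
  measurable D -> measurable_fun setT h ->
  measurable_fun setT F -> (forall x, 0 <= F x) ->
  measurable_fun setT
    (fun a : R => \int[lebesgue_tuple n]_(t in cube D) F [tuple of a :: h t]).
Proof.
move=> mD mh mF F0.
pose G := fun p : R * n.-tuple R =>
  ((fun t => F [tuple of p.1 :: h t]) \_ (cube D)) p.2.
rewrite (_ : (fun a => _) = fubini_F (lebesgue_tuple n) G); last first.
  by apply/funext => a; rewrite integral_mkcond.
apply: measurable_fun_fubini_tonelli_F; last first.
  by move=> p; apply: erestrict_ge0.
rewrite (_ : G = (fun p => F [tuple of p.1 :: h p.2]) \_ (setT `*` cube D)); last first.
  apply/funext => -[a t]; rewrite /G !patchE/=.
  by congr (if _ then _ else _); apply/idP/idP; rewrite !inE; [split|case].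
apply/(measurable_restrictT _ (measurableX measurableT (measurable_cube mD))).
apply: measurable_funTS; apply: measurableT_comp => //.
apply: (measurable_cons measurable_fst).
exact: measurableT_comp mh measurable_snd.
Qed.

(** A change of variable valid in each coordinate separately is valid for the
    product, by induction on the dimension with Tonelli's theorem.  It serves
    twice: for the translations of the torus ([k = 1], different maps in
    different coordinates) and for the scaling of a cube. *)
Lemma ge0_integral_map_coord n (k : R) (D E : set R)
    (phi : 'I_n -> R -> R) (psi : R -> R) :
  measurable D -> measurable E -> (0 <= k)%R ->
  (forall i, measurable_fun setT (phi i)) -> measurable_fun setT psi ->
  (forall i (f : R -> \bar R), measurable_fun setT f -> (forall x, 0 <= f x) ->
    \int[mu]_(y in D) f (phi i y) = k%:E * \int[mu]_(y in E) f (psi y)) ->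
  forall F : n.-tuple R -> \bar R,
  measurable_fun setT F -> (forall x, 0 <= F x) ->
  \int[lebesgue_tuple n]_(x in cube D) F (map_coord phi x) =
  (k ^+ n)%:E * \int[lebesgue_tuple n]_(x in cube E) F (map_coord (fun=> psi) x).
Proof.
move=> mD mE k0; elim: n phi => [|n IHn] phi mphi mpsi h F mF F0.
  rewrite mul1e.
  have cT A : cube A = [set: 0.-tuple R] by apply/seteqP; split => // x _ [].
  rewrite !cT; apply: eq_integral => x _; congr (F _).
  by apply: eq_from_tnth => -[].
have mFm psi' : (forall i, measurable_fun setT (psi' i)) ->
    measurable_fun setT (fun x => F (map_coord psi' x)).
  by move=> ?; apply: measurableT_comp => //; exact: measurable_map_coord.
rewrite !ge0_integral_cubeS//; [|exact: mFm..].
pose H z := \int[lebesgue_tuple n]_(t in cube E)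
  F [tuple of z :: map_coord (fun=> psi) t].
have mH : measurable_fun setT H.
  by apply: measurable_integral_cube => //; exact: measurable_map_coord.
have H0 z : 0 <= H z by exact: integral_ge0.
transitivity (\int[mu]_(a in D) ((k ^+ n)%:E * H (phi ord0 a))).
  apply: eq_integral => a _.
  under eq_integral do rewrite map_coord_cons.
  rewrite (IHn _ _ _ _ (fun t => F [tuple of phi ord0 a :: t]))//.
  - by move=> i; exact: h.
  - apply: (measurableT_comp mF).
    by apply: (measurable_cons (measurable_cst _)).
rewrite ge0_integralZl//=; last 2 first.
- by apply: measurable_funTS; exact: (measurableT_comp mH (mphi ord0)).
- by rewrite lee_fin exprn_ge0.
rewrite h// muleA -EFinM exprSr; congr (_ * _).
apply: eq_integral => a _; apply: eq_integral => t _.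
by rewrite map_coord_cons.
Qed.

End tuple_integral.

(** * The toroidal distance *)

Section torus_distance.
Context {R : realType}.
Local Notation mu := (@lebesgue_measure R).
Local Notation half_itv := (`]- (2^-1 : R), 2^-1]%classic).

(** The distance from [t] to the nearest integer, written with [Num.floor] so
    that its measurability is apparent. *)
Definition int_dist (t : R) : R :=
  Num.min (t - (Num.floor t)%:~R) (1 - (t - (Num.floor t)%:~R)).

Lemma int_dist_ge0 t : 0 <= int_dist t.
Proof.
have /andP[h1 h2] := floor_itv t; move: h2; rewrite intrD => h2.
by rewrite /int_dist le_min; apply/andP; split; lra.
Qed.

Lemma int_dist_le t (z : int) : int_dist t <= `|t - z%:~R|.
Proof.
have /andP[h1 h2] := floor_itv t; move: h2; rewrite intrD => h2.
rewrite /int_dist ge_min; case: (leP z (Num.floor t)) => hz.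
  have hz' : (z%:~R : R) <= (Num.floor t)%:~R by rewrite ler_int.
  apply/orP; left; apply: le_trans (ler_norm _); lra.
have hz' : ((Num.floor t)%:~R + 1 : R) <= z%:~R by rewrite -[1]/(1%:~R) -intrD ler_int lezD1.
apply/orP; right; rewrite distrC; apply: le_trans (ler_norm _); lra.
Qed.

Lemma int_dist_attained t : exists z : int, int_dist t = `|t - z%:~R|.
Proof.
have /andP[h1 h2] := floor_itv t; move: h2; rewrite intrD => h2.
rewrite /int_dist /Num.min; case: ifPn => _.
  by exists (Num.floor t); rewrite ger0_norm// subr_ge0.
exists (Num.floor t + 1); rewrite distrC intrD ger0_norm; lra.
Qed.

(** If [z] is within 1/2 of [t], every other integer is at least 1/2 away. *)
Lemma int_dist_near t (z : int) : `|t - z%:~R| <= 2^-1 -> int_dist t = `|t - z%:~R|.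
Proof.
move=> h; apply/eqP; rewrite eq_le int_dist_le /=.
have [z' ->] := int_dist_attained t.
have [->//|zz'] := eqVneq z z'.
have : 1 <= `|z%:~R - z'%:~R : R|.
  rewrite -intrB -intr_norm -[1]/(1%:~R) ler_int.
  by rewrite -gtz0_ge1 normr_gt0 subr_eq0.
have := ler_distD t (z%:~R : R) z'%:~R; rewrite (distrC _ t) => ? ?.
lra.
Qed.

Lemma int_distDz t (z : int) : int_dist (t + z%:~R) = int_dist t.
Proof.
rewrite /int_dist floorDrz ?intr_int// intrKfloor intrD.
by congr (Num.min _ (1 - _)); ring.
Qed.

Lemma measurable_int_dist : measurable_fun setT int_dist.
Proof.
have mfloor : measurable_fun setT (fun t : R => (Num.floor t)%:~R : R).
  by apply: nondecreasing_measurable => // x y xy; rewrite ler_int le_floor.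
by apply: measurable_minr; repeat apply: measurable_funB.
Qed.

Lemma ge0_integral_shift (a u v : R) (f : R -> \bar R) :
  measurable_fun setT f -> (forall x, 0 <= f x)%E ->
  (\int[mu]_(y in `]u, v]) f y = \int[mu]_(y in `](u - a)%R, (v - a)%R]) f (a + y)%R)%E.
Proof.
move=> mf f0; rewrite [LHS]integral_mkcond (ge0_integral_affine a (ltr01 : 0 < 1 :> R)); last 2 first.
- apply/(measurable_restrictT (D := `]u, v]%classic)) => //.
  exact: measurable_funTS.
- by move=> x; apply: erestrict_ge0.
rewrite mul1e [RHS]integral_mkcond; apply: eq_integral => y _.
rewrite !patchE mul1r; congr (if _ then _ else _).
by apply/idP/idP; rewrite !inE/= !in_itv/= => /andP[? ?]; apply/andP; split; lra.
Qed.

Lemma integral_split_itv (u v w : R) (f : R -> \bar R) : u <= v -> v <= w ->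
  measurable_fun setT f -> (forall x, 0 <= f x)%E ->
  (\int[mu]_(y in `]u, w]) f y =
   \int[mu]_(y in `]u, v]) f y + \int[mu]_(y in `]v, w]) f y)%E.
Proof.
move=> uv vw mf f0.
rewrite (@itv_bndbnd_setU _ _ _ (BRight v))//= ge0_integral_setU//=.
  exact: measurable_funTS.
apply/disj_setPS => y [] /=; rewrite !in_itv/= => /andP[_ h1] /andP[h2 _].
by move: (lt_le_trans h2 h1); rewrite ltxx.
Qed.

(** Cut the interval of integration where [x - y] leaves [-1/2, 1/2]; one piece
    is translated by [- x], the other by [1 - x] or [- 1 - x], and together they
    fill the interval again. *)
Lemma integral_int_dist_in (x : R) (f : R -> \bar R) : - 2^-1 < x <= 2^-1 ->
  measurable_fun setT f -> (forall y, 0 <= f y)%E ->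
  (\int[mu]_(y in half_itv) f (int_dist (x - y)) =
   \int[mu]_(y in half_itv) f `|y|%R)%E.
Proof.
move=> /andP[x1 x2] mf f0.
have mh : measurable_fun setT (fun y : R => f `|y|%R).
  by apply: (measurableT_comp mf); exact: normr_measurable.
have mg : measurable_fun setT (fun y : R => f (int_dist (x - y))).
  apply: (measurableT_comp mf); apply: (measurableT_comp measurable_int_dist).
  by apply: measurable_funB.
have [x0|x0] := leP 0 x.
- rewrite (integral_split_itv (v := x - 2^-1))//; [|lra..].
  rewrite [RHS](integral_split_itv (v := 2^-1 - x))//; [|lra..].
  rewrite [RHS]addeC; congr (_ + _)%E.
  + rewrite [RHS](ge0_integral_shift (1 - x))//.
    rewrite (_ : 2^-1 - x - (1 - x) = - 2^-1); last by field.
    rewrite (_ : 2^-1 - (1 - x) = x - 2^-1); last by field.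
    apply: eq_integral => y; rewrite inE/= in_itv/= => /andP[y1 y2].
    by rewrite (@int_dist_near _ 1) ?ler_norml 1?distrC; [do 2 f_equal; ring|lra].
  + rewrite [RHS](ge0_integral_shift (- x))//.
    rewrite (_ : 2^-1 - x - - x = 2^-1); last by field.
    rewrite (_ : - 2^-1 - - x = x - 2^-1); last by field.
    apply: eq_integral => y; rewrite inE/= in_itv/= => /andP[y1 y2].
    by rewrite (@int_dist_near _ 0) ?subr0 ?ler_norml; [rewrite distrC addrC|lra].
- rewrite (integral_split_itv (v := x + 2^-1))//; [|lra..].
  rewrite [RHS](integral_split_itv (v := - 2^-1 - x))//; [|lra..].
  rewrite [RHS]addeC; congr (_ + _)%E.
  + rewrite [RHS](ge0_integral_shift (- x))//.
    rewrite (_ : - 2^-1 - x - - x = - 2^-1); last by field.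
    rewrite (_ : 2^-1 - - x = x + 2^-1); last by field.
    apply: eq_integral => y; rewrite inE/= in_itv/= => /andP[y1 y2].
    by rewrite (@int_dist_near _ 0) ?subr0 ?ler_norml; [rewrite distrC addrC|lra].
  + rewrite [RHS](ge0_integral_shift (- 1 - x))//.
    rewrite (_ : - 2^-1 - x - (- 1 - x) = 2^-1); last by field.
    rewrite (_ : - 2^-1 - (- 1 - x) = x + 2^-1); last by field.
    apply: eq_integral => y; rewrite inE/= in_itv/= => /andP[y1 y2].
    by rewrite (@int_dist_near _ (-1)) ?ler_norml 1?distrC; [do 2 f_equal; ring|lra].
Qed.

(** Lebesgue measure on the circle is translation invariant. *)
Lemma integral_int_dist (x : R) (f : R -> \bar R) :
  measurable_fun setT f -> (forall y, 0 <= f y)%E ->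
  (\int[mu]_(y in half_itv) f (int_dist (x - y)) =
   \int[mu]_(y in half_itv) f `|y|%R)%E.
Proof.
move=> mf f0; pose z := Num.ceil (x - 2^-1).
have /andP[h1 h2] := ceil_itv (x - 2^-1); move: h1; rewrite -/z in h2 *; rewrite intrB => h1.
rewrite -(@integral_int_dist_in (x - z%:~R))//; last by apply/andP; split; lra.
apply: eq_integral => y _; rewrite -(int_distDz (x - y) (- z)) mulrNz.
by do 2 f_equal; ring.
Qed.

(** The infimum over the integer translations is reached coordinate by
    coordinate, since the Euclidean norm increases with each absolute value. *)
Lemma torus_distE n (x y : n.-tuple R) :
  torus_dist x y = Num.sqrt (\sum_(i < n) int_dist (tnth x i - tnth y i) ^+ 2).
Proof.
rewrite /torus_dist; set A := [set _ | _ in _].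
have Am : A (Num.sqrt (\sum_(i < n) int_dist (tnth x i - tnth y i) ^+ 2)).
  have [z zP] := choice (fun i => int_dist_attained (tnth x i - tnth y i)).
  exists z => //; rewrite /euclid_norm; congr Num.sqrt.
  by apply: eq_bigr => i _; rewrite tnth_mktuple zP real_normK// num_real.
have Alb : lbound A (Num.sqrt (\sum_(i < n) int_dist (tnth x i - tnth y i) ^+ 2)).
  move=> _ [z _ <-]; rewrite ler_wsqrtr// ler_sum// => i _.
  rewrite tnth_mktuple -[leRHS]real_normK ?num_real//.
  by rewrite lerXn2r ?nnegrE ?int_dist_ge0// int_dist_le.
apply/eqP; rewrite eq_le; apply/andP; split.
  by apply: (ge_inf _ Am); eexists; exact: Alb.
by apply: lb_le_inf => //; eexists; exact: Am.
Qed.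

Lemma torus_distC n (x y : n.-tuple R) : torus_dist x y = torus_dist y x.
Proof.
rewrite /torus_dist; congr inf; apply/seteqP; split => _ [z _ <-];
  exists (fun i => - z i) => //; rewrite /euclid_norm; congr Num.sqrt;
  by apply: eq_bigr => i _; rewrite !tnth_mktuple mulrNz -sqrrN; f_equal; ring.
Qed.

Lemma torus_dist_map_coord n (x y : n.-tuple R) :
  torus_dist x y = euclid_norm (map_coord (fun i t => int_dist (tnth x i - t)) y).
Proof.
rewrite torus_distE /euclid_norm; congr Num.sqrt.
by apply: eq_bigr => i _; rewrite tnth_mktuple.
Qed.

Lemma euclid_norm_map_norm n (y : n.-tuple R) :
  euclid_norm (map_coord (fun=> Num.norm) y) = euclid_norm y.
Proof.
rewrite /euclid_norm; congr Num.sqrt.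
by apply: eq_bigr => i _; rewrite tnth_mktuple real_normK// num_real.
Qed.

Lemma measurable_euclid_norm n : measurable_fun setT (@euclid_norm R n).
Proof.
apply: (@measurableT_comp _ _ _ _ _ _ (@Num.sqrt R)).
  by apply: continuous_measurable_fun; exact: sqrt_continuous.
apply: measurable_sum => i; apply: measurable_funX; exact: measurable_tnth.
Qed.

Lemma measurable_torus_dist n :
  measurable_fun setT (fun p : n.-tuple R * n.-tuple R => torus_dist p.1 p.2).
Proof.
under eq_fun do rewrite torus_distE.
apply: (@measurableT_comp _ _ _ _ _ _ (@Num.sqrt R)).
  by apply: continuous_measurable_fun; exact: sqrt_continuous.
apply: measurable_sum => i; apply: measurable_funX.
apply: (measurableT_comp measurable_int_dist); apply: measurable_funB.
  exact: (measurableT_comp (measurable_tnth i) measurable_fst).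
exact: (measurableT_comp (measurable_tnth i) measurable_snd).
Qed.

Lemma torus_dist_ge0 n (x y : n.-tuple R) : 0 <= torus_dist x y.
Proof. by rewrite torus_distE sqrtr_ge0. Qed.

Lemma torus_cube n : @torus R n = cube half_itv.
Proof. by apply/seteqP; split => x /= h i; have := h i; rewrite /= in_itv. Qed.

(** The distance from a uniform point of the torus to a fixed point [x] does not
    depend on [x]: it is distributed as the norm of a uniform point. *)
Lemma integral_torus_dist n (x : n.-tuple R) (f : R -> \bar R) :
  measurable_fun setT f -> (forall y, 0 <= f y)%E ->
  (\int[lebesgue_tuple n]_(y in @torus R n) f (torus_dist x y) =
   \int[lebesgue_tuple n]_(y in @torus R n) f (euclid_norm y))%E.
Proof.
move=> mf f0; rewrite !torus_cube.
under eq_integral do rewrite torus_dist_map_coord.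
rewrite (@ge0_integral_map_coord _ n 1 half_itv half_itv
  (fun i t => int_dist (tnth x i - t)) Num.norm _ _ _ _ _ _ (fun y => f (euclid_norm y)))//.
- by rewrite expr1n mul1e; apply: eq_integral => y _; rewrite euclid_norm_map_norm.
- by move=> i; apply: (measurableT_comp measurable_int_dist); apply: measurable_funB.
- by move=> i h mh h0; rewrite mul1e integral_int_dist.
- exact: (measurableT_comp mf (@measurable_euclid_norm n)).
Qed.

Lemma integral_cube_scale n (s : R) (D : set R) (f : n.-tuple R -> \bar R) : 0 < s ->
  measurable D -> measurable_fun setT f -> (forall y, 0 <= f y)%E ->
  (\int[lebesgue_tuple n]_(y in cube D) f (map_coord (fun=> *%R s^-1) y) =
   (s ^+ n)%:E * \int[lebesgue_tuple n]_(y in cube (( *%R s) @^-1` D)) f y)%E.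
Proof.
move=> s0 mD mf f0.
have mE : measurable (( *%R s) @^-1` D).
  by rewrite -[X in measurable X]setTI; exact: mulrl_measurable.
rewrite (@ge0_integral_map_coord _ n s D _
  (fun=> *%R s^-1) id _ mE _ _ _ _ f)//.
- congr (_ * _)%E; apply: eq_integral => y _; congr (f _).
  by apply: eq_from_tnth => i; rewrite tnth_mktuple.
- exact: ltW.
- move=> _ h mh h0; rewrite [LHS]integral_mkcond.
  rewrite (ge0_integral_affine 0 s0); last 2 first.
  + apply/(measurable_restrictT _ mD); apply: measurable_funTS.
    by apply: (measurableT_comp mh); exact: mulrl_measurable.
  + by move=> x; apply: erestrict_ge0.
  congr (_ * _)%E; rewrite [RHS]integral_mkcond; apply: eq_integral => y _.
  by rewrite !patchE add0r mulKf// gt_eqF.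
Qed.

End torus_distance.

(** * Integrals of the connection function *)

Section tail.
Context {R : realType} (d : nat) (g : R -> R).
Hypothesis g_01 : forall x : R, 0 <= x -> 0 <= g x <= 1.
Hypothesis g_noninc : forall x y : R, 0 <= x -> x <= y -> g y <= g x.

Local Notation box M := (@cube R d (`](- (M : R))%R, (M : R)]%classic)).

Lemma euclid_norm_ge0 n (x : n.-tuple R) : 0 <= euclid_norm x.
Proof. exact: sqrtr_ge0. Qed.

Lemma norm_coord_le_euclid_norm n (x : n.-tuple R) i : `|tnth x i| <= euclid_norm x.
Proof.
rewrite -sqrtr_sqr /euclid_norm ler_wsqrtr// (bigD1 i)//= lerDl.
by apply: sumr_ge0 => j _; exact: sqr_ge0.
Qed.

Lemma g_ge0 x : 0 <= x -> 0 <= g x. Proof. by move=> /g_01/andP[]. Qed.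

(** Monotonicity of [g] is known on nonnegative reals only, hence the detour
    through [g \o Num.max 0], which is monotone on the whole line. *)
Lemma measurable_comp_nonincreasing {disp} {T : measurableType disp} (D : set T) (h : T -> R) :
  (forall x, 0 <= h x) -> measurable_fun D h -> measurable_fun D (g \o h).
Proof.
move=> h0 mh.
pose g0 x := g (Num.max 0 x).
have -> : g \o h = g0 \o h by apply/funext => x /=; rewrite /g0 max_r.
apply: measurableT_comp mh.
apply: nonincreasing_measurable => // x y xy.
by apply: g_noninc; rewrite ?ge_max !le_max lexx// xy orbT.
Qed.

Lemma lebesgue_tuple_cube (M : R) : 0 <= M -> lebesgue_tuple d (box M) = ((2 * M) ^+ d)%:E.
Proof.
move=> M0; rewrite (lebesgue_tuple_box (A := fun=> `](- M)%R, M]%classic))//.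
rewrite (eq_bigr (fun=> (2 * M)%:E)); last first.
  move=> i _; rewrite lebesgue_measure_itv/= lte_fin.
  case: ltP => [_|h]; first by rewrite -EFinD opprK mulr2n mulrDl mul1r.
  have -> : M = 0 by lra.
  by rewrite mulr0.
by rewrite prodEFin prodr_const card_ord.
Qed.

(** Outside the cube of half-side [M], cover space by the shells between the
    cubes of half-sides [2 ^+ k * M] and [2 ^+ k.+1 * M].  On such a shell [g] is
    at most [(2 ^+ k * M) `^ (- c)] while the outer cube has volume
    [(4 * (2 ^+ k * M)) ^+ d]; as [d < c], these bounds form a geometric series. *)
Lemma integral_tail_le (c M : R) : d%:R < c -> 0 < M ->
  (forall x, M <= x -> g x <= x `^ (- c)) ->
  (\int[lebesgue_tuple d]_(x in ~` box M) (g (euclid_norm x))%:E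
    <= (4 ^+ d / (1 - 2 `^ (d%:R - c)) * M `^ (d%:R - c))%:E)%E.
Proof.
move=> cd M0 gM.
pose rho : R := 2 `^ (d%:R - c).
have rho0 : 0 <= rho by exact: powR_ge0.
have rho1 : rho < 1.
  by rewrite -[ltRHS](powRr0 2) /rho /powR pnatr_eq0/= ltr_expR ltr_pM2r ?ln_gt0 ?ltr1n// subr_lt0.
have M2 k : 0 < 2 ^+ k * M by rewrite mulr_gt0// exprn_gt0.
pose F k (x : d.-tuple R) := (((2 ^+ k * M) `^ (- c))%:E * (\1_(box (2 ^+ k.+1 * M)) x)%:E)%E.
have mbox N : measurable (box N) by exact: measurable_cube.
have F0 k x : (0 <= F k x)%E by rewrite mule_ge0// lee_fin ?powR_ge0.
have mF k : measurable_fun setT (F k).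
  by apply/measurable_EFinP; apply: measurable_funM => //; exact: measurable_indic.
have mg : measurable_fun setT (fun x : d.-tuple R => (g (euclid_norm x))%:E).
  apply/measurable_EFinP; apply: measurable_comp_nonincreasing => //.
    by move=> x; exact: euclid_norm_ge0.
  exact: measurable_euclid_norm.
apply: (@le_trans _ _ (\int[lebesgue_tuple d]_(x in ~` box M) (\sum_(0 <= k <oo) F k x))%E).
  apply: ge0_le_integral => //.
  - exact: measurableC.
  - by move=> x _; rewrite lee_fin g_ge0// euclid_norm_ge0.
  - exact: measurable_funTS.
  - apply: measurable_funTS; apply: ge0_emeasurable_sum => //.
  move=> x Mx.
  (* The least [k] for which the k-th shell's outer cube contains [x]. *)
  have ex_k : exists k, x \in box (2 ^+ k.+1 * M).
    have [K KP] : exists K : nat, forall i, `|tnth x i| < 2 ^+ K.+1 * M.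
      exists (Num.bound (euclid_norm x / M)) => i.
      apply: le_lt_trans (norm_coord_le_euclid_norm x i) _.
      rewrite -ltr_pdivrMr//; apply: lt_le_trans (archi_boundP _) _.
        by rewrite divr_ge0 ?euclid_norm_ge0 ?ltW.
      by rewrite -natrX ler_nat ltnW// ltnW// ltn_expl.
    exists K; rewrite inE => i; rewrite /= in_itv/=.
    by have := KP i; rewrite ltr_norml => /andP[-> /ltW].
  case: (ex_minnP ex_k) => k kx kmin.
  have xk : ~ box (2 ^+ k * M) x.
    case: k kx kmin => [|k] _ kmin; first by rewrite expr0 mul1r.
    by move=> xk; have := kmin k; rewrite ltnn => /implyP; rewrite mem_set.
  have [i hi] : exists i, 2 ^+ k * M <= `|tnth x i|.
    move: xk; rewrite /cube /= => /existsNP[i]; rewrite /= in_itv/= => /negP hi.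
    exists i; rewrite leNgt; apply: contra hi.
    by rewrite ltr_norml => /andP[-> /ltW].
  apply: (@le_trans _ _ (F k x)); last first.
    apply: le_trans (nneseries_lim_ge k.+1 _) => [|//].
    by rewrite big_nat_recr//= leeDr// sume_ge0.
  rewrite /F indicE kx mule1 lee_fin.
  apply: le_trans (g_noninc _ (le_trans hi (norm_coord_le_euclid_norm x i))) _.
    exact: ltW.
  by apply: gM; apply: ler_peMl (ltW M0) _; rewrite exprn_ege1// ler1n.
apply: (@le_trans _ _ (\int[lebesgue_tuple d]_x (\sum_(0 <= k <oo) F k x))%E).
  apply: ge0_subset_integral => //; first exact: measurableC.
    by apply: ge0_emeasurable_sum.
  by move=> x _; apply: nneseries_ge0.
rewrite integral_nneseries//.
have intF k : (\int[lebesgue_tuple d]_x F k x = (4 ^+ d * M `^ (d%:R - c) * rho ^+ k)%:E)%E.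
  rewrite ge0_integralZl//; last 2 first.
  - by apply/measurable_EFinP; exact: measurable_indic.
  - by rewrite lee_fin powR_ge0.
  rewrite integral_indic// setIT.
  rewrite [X in (_ * X)%E](_ : _ = ((2 * (2 ^+ k.+1 * M)) ^+ d)%:E); last first.
    exact: lebesgue_tuple_cube (ltW (M2 k.+1)).
  rewrite -EFinM; congr EFin.
  have -> : 2 * (2 ^+ k.+1 * M) = 4 * (2 ^+ k * M) by rewrite exprS; ring.
  rewrite exprMn mulrCA -mulrA; congr (_ * _).
  rewrite -(powR_mulrn d (ltW (M2 k))) -powRD; last by apply/implyP => _; rewrite gt_eqF.
  rewrite addrC powRM ?exprn_ge0 ?ltW// mulrC; congr (_ * _).
  by rewrite -powR_mulrn// powRAC powR_mulrn.
under eq_eseriesr do rewrite intF.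
have : series (geometric (4 ^+ d * M `^ (d%:R - c)) rho) @ \oo -->
    4 ^+ d * M `^ (d%:R - c) / (1 - rho).
  by apply: cvg_geometric_series; rewrite ger0_norm.
move=> hc.
rewrite (_ : limn _ = (4 ^+ d * M `^ (d%:R - c) / (1 - rho))%:E).
  by rewrite lee_fin -/rho mulrAC.
apply/cvg_lim => //.
apply: cvg_EFin.
  by apply: nearW => n; rewrite sumEFin.
apply: cvg_trans hc; apply: near_eq_cvg; apply: nearW => n.
by rewrite /= sumEFin.
Qed.

End tail.

Section vertex_mass.
Context {R : realType} (d : nat) (g : R -> R).
Hypothesis g_01 : forall x : R, 0 <= x -> 0 <= g x <= 1.
Hypothesis g_noninc : forall x y : R, 0 <= x -> x <= y -> g y <= g x.

Local Notation box M := (@cube R d (`](- (M : R))%R, (M : R)]%classic)).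

Lemma decay_powR (c : R) :
  g =o_ (pinfty_nbhs R) (fun x : R => x `^ (- c)) ->
  exists2 M : R, 0 < M & forall x, M <= x -> g x <= x `^ (- c).
Proof.
move=> /eqoP/(_ 1 ltr01)[M [_ MP]].
exists (Num.max 1 (M + 1)); first by rewrite lt_max ltr01.
move=> x; rewrite ge_max => /andP[x1 xM].
have Mx : M < x by lra.
have := MP x Mx.
rewrite mul1r [X in _ <= X]ger0_norm ?powR_ge0// => h.
exact: le_trans (ler_norm _) h.
Qed.

Lemma euclid_norm_scale n (s : R) (x : n.-tuple R) : 0 <= s ->
  euclid_norm (map_coord (fun=> *%R s) x) = s * euclid_norm x.
Proof.
move=> s0; rewrite /euclid_norm -[in RHS](ger0_norm s0) -sqrtr_sqr.
rewrite -sqrtrM ?sqr_ge0// mulr_sumr; congr Num.sqrt.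
by apply: eq_bigr => i _; rewrite tnth_mktuple exprMn.
Qed.

(** The probability [q] that a given vertex is joined to a uniform one, up to a
    relative error [O(r `^ (c - d))].  Scaling by [r] turns [q] into [r ^+ d]
    times the integral of [g] over the cube of half-side [(2 * r)^-1], which
    misses only the tail of [alpha]. *)
Lemma connection_mass_bounds (alpha c : R) :
  (\int[lebesgue_tuple d]_x (g (euclid_norm x))%:E = alpha%:E)%E ->
  d%:R < c -> g =o_ (pinfty_nbhs R) (fun x : R => x `^ (- c)) ->
  exists C M : R, [/\ 0 <= C, 0 < M & forall r, 0 < r -> M <= (2 * r)^-1 ->
    exists q : R,
     [/\ (\int[lebesgue_tuple d]_(y in @torus R d) (g (euclid_norm y / r))%:E = q%:E)%E,
         r ^+ d * (alpha - C * (2 * r) `^ (c - d%:R)) <= q & q <= r ^+ d * alpha]].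
Proof.
move=> alphaE cd /decay_powR[M M0 MP].
pose C : R := 4 ^+ d / (1 - 2 `^ (d%:R - c)).
have C0 : 0 <= C.
  rewrite divr_ge0 ?exprn_ge0// subr_ge0 -[leRHS](powRr0 2).
  by rewrite ler_powR ?ler1n// subr_le0 ltW.
exists C, M; split => // r r0 Mr; set N := (2 * r)^-1.
have N0 : 0 < N by rewrite invr_gt0 mulr_gt0.
have mbox : measurable (box N) by exact: measurable_cube.
have mg : measurable_fun setT (fun x : d.-tuple R => (g (euclid_norm x))%:E).
  apply/measurable_EFinP; apply: (measurable_comp_nonincreasing g_noninc).
    by move=> x; exact: euclid_norm_ge0.
  exact: measurable_euclid_norm.
have g0 (x : d.-tuple R) : (0 <= (g (euclid_norm x))%:E)%E.
  by rewrite lee_fin (g_ge0 g_01)// euclid_norm_ge0.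
have split_alpha : (\int[lebesgue_tuple d]_(x in box N) (g (euclid_norm x))%:E +
    \int[lebesgue_tuple d]_(x in ~` box N) (g (euclid_norm x))%:E = alpha%:E)%E.
  rewrite -ge0_integral_setU ?setUv//; first exact: measurableC.
  by apply/disj_setPS; rewrite setICr.
have tail := @integral_tail_le R d g g_01 g_noninc c N cd N0
  (fun x Nx => MP x (le_trans Mr Nx)).
move: split_alpha tail.
have : (0 <= \int[lebesgue_tuple d]_(x in box N) (g (euclid_norm x))%:E)%E.
  by apply: integral_ge0 => x _.
have : (0 <= \int[lebesgue_tuple d]_(x in ~` box N) (g (euclid_norm x))%:E)%E.
  by apply: integral_ge0 => x _.
set tau := (\int[_]_(x in ~` _) _)%E.
case bE : (\int[lebesgue_tuple d]_(x in box N) (g (euclid_norm x))%:E)%E =>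
  [beta| |]//; move: tau => [tau| |]//; rewrite !lee_fin => tau0 beta0.
rewrite -EFinD => -[ab] tauC.
exists (r ^+ d * beta); split.
- transitivity ((r ^+ d)%:E * \int[lebesgue_tuple d]_(x in box N) (g (euclid_norm x))%:E)%E; last first.
    by rewrite bE.
  have -> : box N = cube ( *%R r @^-1` `]- (2^-1 : R), 2^-1]%classic).
    congr cube; apply/seteqP; split=> x /=; rewrite !in_itv/= /N invfM.
      by move=> /andP[]; rewrite -mulNr ltr_pdivrMr// ler_pdivlMr// ![_ * r]mulrC => -> ->.
    by rewrite -mulNr ltr_pdivrMr// ler_pdivlMr// ![_ * r]mulrC.
  rewrite -integral_cube_scale// torus_cube; apply: eq_integral => y _.
  by rewrite euclid_norm_scale ?invr_ge0 ?ltW// mulrC.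
- rewrite ler_pM2l ?exprn_gt0//.
  have -> : (2 * r) `^ (c - d%:R) = N `^ (d%:R - c).
    rewrite /N -powR_inv1 ?mulr_ge0 ?ltW// -powRrM; congr (_ `^ _); ring.
  by rewrite -ab lerBlDr lerD2l.
- by rewrite ler_pM2l ?exprn_gt0// -ab lerDl.
Qed.

End vertex_mass.

(** * Asymptotics of the exact expectation *)

Section limit.
Context {R : realType}.

Lemma cvg_powR_natN (s : R) : 0 < s -> (n%:R `^ (- s) : R) @[n --> \oo] --> 0.
Proof.
move=> s0; rewrite -(cvg_shiftS (fun n => n%:R `^ (- s) : R)).
have -> : (fun n => n.+1%:R `^ (- s)) = (fun n => harmonic n `^ s) :> (nat -> R).
  by apply/funext => n; rewrite /harmonic powRN -powR_inv1// powRAC powR_inv1// powR_ge0.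
have /cvg_at_rightP := powR_cvg0 s0.
by apply; split; [move=> n; exact: harmonic_gt0|exact: cvg_harmonic].
Qed.

Lemma ln_le_powR (p x : R) : 0 < p -> 0 < x -> ln x <= p^-1 * x `^ p.
Proof.
move=> p0 x0; rewrite -(ler_pM2l p0) mulrA mulfV ?gt_eqF// mul1r -ln_powR.
by rewrite ltW// ln_sublinear// powR_gt0.
Qed.

(** Write [n * expR (- (n * q))] as [expR (ln n - n * q)].  The bounds on [q]
    confine [ln n - n * q + b] between 0 and a multiple of
    [(ln n + b) * r `^ (c - d)].  As [r ^+ d] is [n^-1] up to a logarithm, which
    is [O(n `^ p)] for any [p > 0], this error is bounded by a negative power of
    [n]. *)
Lemma cvg_isolated_limit (d : nat) (alpha b c C M : R) (r : nat -> R)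
    (W : nat -> \bar R) :
  (0 < d)%N -> 0 < alpha -> d%:R < c -> 0 <= C -> 0 < M ->
  (forall n, (0 < n)%N -> 0 < (ln n%:R + b) / (alpha * n%:R) ->
     0 < r n /\ r n ^+ d = (ln n%:R + b) / (alpha * n%:R)) ->
  (forall n, (0 < n)%N -> 0 < r n -> M <= (2 * r n)^-1 -> exists q : R,
     [/\ W n = (n%:R * expR (- (n%:R * q)))%:E,
         r n ^+ d * (alpha - C * (2 * r n) `^ (c - d%:R)) <= q &
         q <= r n ^+ d * alpha]) ->
  W n @[n --> \oo] --> (expR (- b))%:E.
Proof.
move=> d0 al0 cd C0 M0 rE WE.
have {WE} /choice[q qE] : forall n, exists q : R,
    (0 < n)%N -> 0 < r n -> M <= (2 * r n)^-1 ->
    [/\ W n = (n%:R * expR (- (n%:R * q)))%:E,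
        r n ^+ d * (alpha - C * (2 * r n) `^ (c - d%:R)) <= q &
        q <= r n ^+ d * alpha].
  move=> n.
  have [[n0 rn0 Mr]|large] := pselect [/\ (0 < n)%N, 0 < r n & M <= (2 * r n)^-1].
    by have [q qP] := WE n n0 rn0 Mr; exists q.
  by exists 0 => n0 rn0 Mr; exfalso; apply: large.
have d0' : 0 < d%:R :> R by rewrite ltr0n.
pose eta := (c - d%:R) / d%:R.
have eta0 : 0 < eta by rewrite divr_gt0// subr_gt0.
(* This [p] makes [p - (1 - p) * eta], the exponent of [n] in the error term,
   equal to [- (eta / 2)]. *)
pose p := eta / (2 * (1 + eta)).
have eta1 : 0 < 1 + eta by lra.
have p0 : 0 < p by rewrite divr_gt0// mulr_gt0.
have p1 : 0 < 1 - p.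
  rewrite subr_gt0 /p ltr_pdivrMr ?mulr_gt0// mul1r; lra.
pose K := p^-1 + `|b|.
have K0 : 0 < K by rewrite ltr_wpDr// invr_gt0.
have LK n : (0 < n)%N -> ln n%:R + b <= K * n%:R `^ p.
  move=> n0; rewrite mulrDl; apply: lerD; first by rewrite ln_le_powR// ltr0n.
  apply: le_trans (ler_norm b) _; apply: ler_peMr => //.
  by rewrite -[leLHS](powRr0 n%:R) ler_powR ?ler1n// ltW.
have rdK n : (0 < n)%N -> 0 < r n -> r n ^+ d = (ln n%:R + b) / (alpha * n%:R) ->
    r n ^+ d <= K / alpha * n%:R `^ (- (1 - p)).
  move=> n0 rn0 ->; rewrite ler_pdivrMr ?mulr_gt0 ?ltr0n//.
  apply: le_trans (LK n n0) _; rewrite mulrACA divfK ?gt_eqF//.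
  have -> : n%:R `^ (- (1 - p)) * n%:R = n%:R `^ p :> R.
    rewrite -[X in _ * X](powRr1 (ler0n R n)) -powRD; last first.
      by apply/implyP => _; rewrite pnatr_eq0 -lt0n.
    by congr (_ `^ _); ring.
  by [].
pose K' := K * (2 ^+ d * (K / alpha)) `^ eta.
have errK n : (0 < n)%N -> 0 < r n -> r n ^+ d = (ln n%:R + b) / (alpha * n%:R) ->
    0 <= ln n%:R + b ->
    (ln n%:R + b) * (2 * r n) `^ (c - d%:R) <= K' * n%:R `^ (- (eta / 2)).
  move=> n0 rn0 rd L0.
  have -> : (2 * r n) `^ (c - d%:R) = (2 ^+ d * r n ^+ d) `^ eta.
    rewrite -exprMn -powR_mulrn ?mulr_ge0 ?ltW// -powRrM; congr (_ `^ _).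
    by rewrite /eta mulrC divfK// gt_eqF.
  have h1 : (2 ^+ d * r n ^+ d) `^ eta <=
      (2 ^+ d * (K / alpha)) `^ eta * n%:R `^ (- (1 - p) * eta).
    rewrite (powRrM n%:R) -powRM ?mulr_ge0 ?powR_ge0 ?invr_ge0 ?exprn_ge0 ?(ltW K0) ?(ltW al0)//.
    apply: ge0_ler_powR; rewrite ?(ltW eta0) ?nnegrE ?mulr_ge0 ?powR_ge0 ?invr_ge0 ?exprn_ge0 ?(ltW K0) ?(ltW al0) ?(ltW rn0)//.
    by rewrite -mulrA ler_pM2l ?exprn_gt0// rdK.
  apply: le_trans (ler_pM L0 (powR_ge0 _ _) (LK n n0) h1) _.
  rewrite mulrACA /K' le_eqVlt; apply/orP; left; apply/eqP; congr (_ * _).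
  rewrite -powRD; last by apply/implyP => _; rewrite pnatr_eq0 -lt0n.
  congr (_ `^ _); rewrite /p; field; lra.
have near_r : \forall n \near \oo,
    [/\ (0 < n)%N, 0 <= ln n%:R + b, 0 < r n,
        r n ^+ d = (ln n%:R + b) / (alpha * n%:R) & M <= (2 * r n)^-1].
  have : \forall n \near \oo, K / alpha * n%:R `^ (- (1 - p)) < (2 * M) ^- d.
    have h : (K / alpha * n%:R `^ (- (1 - p)) : R) @[n --> \oo] --> K / alpha * 0.
      by apply: cvgMl_tmp; exact: cvg_powR_natN.
    rewrite mulr0 in h.
    by apply: (cvgr_lt _ h); rewrite invr_gt0 exprn_gt0// mulr_gt0.
  have hb : \forall n \near \oo, expR (- b) < n%:R by exact: nbhs_infty_gtr.
  apply: filterS2 hb => n nb nM.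
  have n0R : 0 < n%:R :> R by apply: lt_trans nb; exact: expR_gt0.
  have n0 : (0 < n)%N by rewrite ltr0n in n0R.
  have L0 : 0 < ln n%:R + b.
    by rewrite -(opprK b) subr_gt0 -(expRK (- b)) ltr_ln// posrE// expR_gt0.
  have [rn0 rd] : 0 < r n /\ r n ^+ d = (ln n%:R + b) / (alpha * n%:R).
    by apply: rE => //; rewrite divr_gt0// mulr_gt0.
  split => //; first exact: ltW.
  have := le_lt_trans (rdK n n0 rn0 rd) nM.
  rewrite -exprVn ltr_pXn2r ?nnegrE ?invr_ge0 ?mulr_ge0 ?(ltW rn0) ?(ltW M0)// => rM.
  rewrite -[leLHS]invrK lef_pV2 ?posrE ?invr_gt0 ?mulr_gt0//.
  by rewrite -ler_pdivlMl// -invfM ltW.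
have sandwich : \forall n \near \oo,
    - b <= ln n%:R - n%:R * q n <= - b + C / alpha * K' * n%:R `^ (- (eta / 2)).
  apply: filterS near_r => n [n0 L0 rn0 rd Mr].
  have n0R : 0 < n%:R :> R by rewrite ltr0n.
  have nrd : n%:R * (r n ^+ d) = (ln n%:R + b) / alpha.
    by rewrite rd; field; rewrite !gt_eqF.
  have [_ q1 q2] := qE n n0 rn0 Mr.
  have {q2}nq2 : n%:R * q n <= ln n%:R + b.
    by rewrite -(ler_pM2l n0R) mulrA nrd divfK ?gt_eqF// in q2.
  have {q1}nq1 : ln n%:R + b - C / alpha * ((ln n%:R + b) * (2 * r n) `^ (c - d%:R)) <= n%:R * q n.
    rewrite -(ler_pM2l n0R) mulrA nrd in q1; apply: le_trans q1.
    by rewrite le_eqVlt; apply/orP; left; apply/eqP; field; rewrite gt_eqF.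
  have := ler_wpM2l (divr_ge0 C0 (ltW al0)) (errK n n0 rn0 rd L0).
  rewrite mulrA => he; apply/andP; split; lra.
have cvg_exponent : ln n%:R - n%:R * q n @[n --> \oo] --> - b.
  apply: (squeeze_cvgr sandwich); first exact: cvg_cst.
  rewrite -[X in _ --> X]addr0; apply: cvgD; first exact: cvg_cst.
  rewrite -(mulr0 (C / alpha * K')); apply: cvgMl_tmp.
  by apply: cvg_powR_natN; rewrite divr_gt0.
apply: cvg_EFin.
  by apply: filterS near_r => n [n0 _ rn0 _ Mr]; have [->] := qE n n0 rn0 Mr.
apply: cvg_trans (cvg_comp _ _ cvg_exponent (@continuous_expR R (- b))).
apply: near_eq_cvg; apply: filterS near_r => n [n0 _ rn0 _ Mr] /=.
have [-> _ _] := qE n n0 rn0 Mr.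
by rewrite /= expRD lnK// posrE ltr0n.
Qed.

End limit.

(** * A vertex and its independent neighbours *)

Section star.
Context {R : realType}.
Local Open Scope ereal_scope.

Lemma measurable_bigsetI {disp} {T : measurableType disp} {I : Type} (s : seq I)
    (F : I -> set T) :
  (forall i, measurable (F i)) -> measurable (\big[setI/setT]_(i <- s) F i).
Proof. by move=> mF; elim/big_ind : _ => // A B; exact: measurableI. Qed.

Lemma measurable_preimage {d1 d2} {T1 : measurableType d1} {T2 : measurableType d2}
  (f : T1 -> T2) (B : set T2) : measurable_fun setT f -> measurable B ->
  measurable (f @^-1` B).
Proof. by move=> mf mB; rewrite -[X in measurable X]setTI; exact: mf. Qed.

(** Uniqueness of the product measure: the joint law of [Z] and [W] on the event
    [E] is determined by rectangles. *)
Lemma measure_independent_pair {disp d1 d2} {T : measurableType disp}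
    {T1 : measurableType d1} {T2 : measurableType d2}
    (P : {measure set T -> \bar R})
    (l1 : probability T1 R) (l2 : {sigma_finite_measure set T2 -> \bar R})
    (c : {nonneg R})
    (E : set T) (Z : T -> T1) (W : T -> T2) :
  measurable E -> measurable_fun setT Z -> measurable_fun setT W ->
  (forall B H, measurable B -> measurable H ->
    P (E `&` (Z @^-1` B `&` W @^-1` H)) = c%:num%:E * l1 B * l2 H) ->
  forall Q, measurable Q ->
    P (E `&` (fun w => (Z w, W w)) @^-1` Q) =
    c%:num%:E * \int[l1]_x l2 (xsection Q x).
Proof.
move=> mE mZ mW PE Q mQ.
have mZW : measurable_fun setT (fun w => (Z w, W w)) by exact: measurable_fun_pair.
transitivity ((mscale c l1 \x l2) Q).
  apply/esym; rewrite setIC.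
  apply: (product_measure_unique (m' := image_measure (mrestr P mE) mZW)) => //.
  move=> A B mA mB; rewrite -[LHS]/(P (_ `&` E)) setIC.
  by rewrite (_ : _ @^-1` _ = Z @^-1` A `&` W @^-1` B)// PE.
rewrite /product_measure1 ge0_integral_mscale//.
exact: measurable_fun_xsection.
Qed.

(** A center [Z] and independent satellites [(Y j, V j)], each required to satisfy
    a relation [G] with the center.  When the probability [s] that a satellite
    satisfies [G] does not depend on the position of the center, the constraints
    are independent.  The induction on [J] integrates out one satellite at a
    time; for it to go through, the satellites not yet treated are kept as
    arbitrary rectangles (the list [K] in [star_eq]), which makes the product rule
    on rectangles the only form of independence involved. *)
Lemma measure_star_constraints {disp d1 d2 d3} {T : measurableType disp}
    {T1 : measurableType d1} {T2 : measurableType d2} {T3 : measurableType d3}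
    (P : {measure set T -> \bar R})
    (l1 : probability T1 R) (l2 : probability T2 R) (l3 : probability T3 R)
    (p s : {nonneg R}) (E0 : set T) (I : pred nat)
    (Z : T -> T1) (Y : nat -> T -> T2) (V : nat -> T -> T3) (G : set (T1 * (T2 * T3))) :
  measurable E0 -> measurable_fun setT Z ->
  (forall k, measurable_fun setT (Y k)) -> (forall k, measurable_fun setT (V k)) ->
  measurable G ->
  (forall x, (l2 \x l3) (xsection G x) = s%:num%:E) ->
  (forall B (C : nat -> set T2) (D : nat -> set T3) (K : seq nat),
    measurable B -> (forall k, measurable (C k)) -> (forall k, measurable (D k)) ->
    uniq K -> all I K ->
    P (E0 `&` (Z @^-1` B `&`
      \big[setI/setT]_(k <- K) (Y k @^-1` C k `&` V k @^-1` D k))) =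
    p%:num%:E * l1 B * \prod_(k <- K) (l2 (C k) * l3 (D k))) ->
  forall J : seq nat, uniq J -> all I J ->
  P (E0 `&` \big[setI/setT]_(j <- J) [set w | G (Z w, (Y j w, V j w))]) =
  (p%:num * s%:num ^+ size J)%:E.
Proof.
move=> mE0 mZ mY mV mG Gs base.
pose star J := \big[setI/setT]_(j <- J) [set w | G (Z w, (Y j w, V j w))].
have mYV j : measurable_fun setT (fun w => (Y j w, V j w)).
  exact: measurable_fun_pair.
have mstar J : measurable (star J).
  apply: measurable_bigsetI => j.
  apply: (measurable_preimage (f := fun w => (Z w, (Y j w, V j w)))) => //.
  exact: measurable_fun_pair.
suff star_eq J : forall B (C : nat -> set T2) (D : nat -> set T3) (K : seq nat),
    measurable B -> (forall k, measurable (C k)) -> (forall k, measurable (D k)) ->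
    uniq (J ++ K) -> all I (J ++ K) ->
    P (E0 `&` star J `&` (Z @^-1` B `&`
      \big[setI/setT]_(k <- K) (Y k @^-1` C k `&` V k @^-1` D k))) =
    (p%:num * s%:num ^+ size J)%:E * l1 B * \prod_(k <- K) (l2 (C k) * l3 (D k)).
  move=> J uJ aJ.
  have := star_eq J setT (fun=> setT) (fun=> setT) [::].
  rewrite cats0 !big_nil preimage_setT !setIT => -> //.
  by rewrite mule1 probability_setT mule1.
elim: J => [|j J IH] B C D K mB mC mD uJK aJK.
  by rewrite /star big_nil setIT expr0 mulr1 base.
have ujK : uniq (J ++ j :: K).
  by rewrite -cat1s uniq_catCA.
have aIjK : all I (J ++ j :: K).
  by move: aJK; rewrite /= !all_cat /= andbCA.
have jK : j \notin K by move: uJK => /= /andP[]; rewrite mem_cat negb_or => /andP[].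
pose RK := \big[setI/setT]_(k <- K) (Y k @^-1` C k `&` V k @^-1` D k).
have mRK : measurable RK.
  by apply: measurable_bigsetI => k; apply: measurableI; exact: measurable_preimage.
pose prodK := \prod_(k <- K) (l2 (C k) * l3 (D k)).
have prodK_fin : prodK \is a fin_num /\ 0 <= prodK.
  rewrite /prodK; elim/big_ind : _ => //.
    by move=> x y [xf x0] [yf y0]; rewrite fin_numM// mule_ge0.
  by move=> k _; rewrite fin_numM ?fin_num_measure// mule_ge0.
have [prodKf prodK0] := prodK_fin.
have c0 B' : (0 <= p%:num * s%:num ^+ size J * fine prodK * fine (l1 B'))%R.
  by rewrite !mulr_ge0// fine_ge0.
have c1 : (0 <= p%:num * s%:num ^+ size J * fine prodK)%R.
  by rewrite !mulr_ge0// fine_ge0.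
(* The induction hypothesis, with [j] moved from the treated to the free
   satellites. *)
have IHj B' C' D' : measurable B' -> measurable C' -> measurable D' ->
    P (E0 `&` star J `&` RK `&` Z @^-1` B' `&` (Y j @^-1` C' `&` V j @^-1` D')) =
    (p%:num * s%:num ^+ size J)%:E * l1 B' * (l2 C' * l3 D') * prodK.
  move=> mB' mC' mD'.
  have := IH B' (fun k => if k == j then C' else C k) (fun k => if k == j then D' else D k)
    (j :: K) mB'.
  rewrite !big_cons eqxx.
  rewrite (_ : \big[setI/setT]_(k <- K) _ = RK); last first.
    by apply: eq_big_seq => k kK; case: eqP kK jK => // -> ->.
  rewrite (_ : \prod_(k <- K) _ = prodK); last first.
    by apply: eq_big_seq => k kK; case: eqP kK jK => // -> ->.
  rewrite muleA => <- //.
  - by congr (P _); apply/seteqP; split => w; rewrite /setI /mkset; tauto.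
  - by move=> k; case: ifP.
  - by move=> k; case: ifP.
(* Uniqueness of product measures is applied twice: first to [Y j] and [V j]
   with the center confined to a rectangle, then to the center and the pair. *)
have step1 B' Q : measurable B' -> measurable Q ->
    P (E0 `&` star J `&` RK `&` Z @^-1` B' `&` (fun w => (Y j w, V j w)) @^-1` Q) =
    (p%:num * s%:num ^+ size J * fine prodK)%:E * l1 B' * (l2 \x l3) Q.
  move=> mB' mQ.
  rewrite (@measure_independent_pair _ _ _ _ _ _ P l2 l3 (NngNum (c0 B')))//=.
  - by rewrite [in RHS]EFinM -[l1 B' in RHS]fineK ?fin_num_measure// -EFinM.
  - apply: measurableI; last exact: measurable_preimage.
    by do 2 apply: measurableI => //.
  - move=> C' D' mC' mD'; rewrite IHj// !EFinM fineK// fineK ?fin_num_measure//.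
    by rewrite -!muleA; congr (_ * _); congr (_ * _); rewrite [RHS]muleC !muleA.
pose l23 : probability (T2 * T3)%type R := l2 \x l3.
have mGB : measurable (G `&` (B `*` setT)).
  by apply: measurableI => //; exact: measurableX.
rewrite (_ : E0 `&` star (j :: J) `&` _ =
   (E0 `&` star J `&` RK) `&` (fun w => (Z w, (Y j w, V j w))) @^-1` (G `&` (B `*` setT))); last first.
  rewrite /star big_cons -/(star J) -/RK; apply/seteqP.
  by split => w; rewrite /setI /setX /preimage /mkset/=; tauto.
rewrite (measure_independent_pair (l1 := l1) (l2 := l23)
  (c := NngNum c1) _ mZ (mYV j) _ mGB) /=; last 2 first.
- by do 2 apply: measurableI => //.
- by move=> B' Q mB' mQ; rewrite setIA step1.
rewrite (eq_integral (fun x => s%:num%:E * (\1_B x)%:E)); last first.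
  move=> x _; rewrite indicE; case: (boolP (x \in B)) => xB.
    rewrite mule1 -(Gs x); congr (_ _); apply/seteqP; split => y; rewrite /xsection/= !inE.
      by case.
    by move=> Gxy; split => //; split => //; rewrite inE in xB.
  rewrite mule0 (_ : xsection _ _ = set0) ?measure0//.
  apply/seteqP; split => y //; rewrite /xsection/= inE => -[_ [Bx _]].
  by rewrite notin_setE in xB.
rewrite ge0_integralZl//; last by apply/measurable_EFinP; exact: measurable_indic.
rewrite integral_indic// setIT !EFinM exprS !EFinM fineK// !muleA.
rewrite -/prodK [RHS]muleAC; congr (_ * _).
by rewrite -!muleA; congr (_ * _); rewrite !muleA muleC !muleA muleAC.
Qed.

End star.

(** * Independence and laws *)

Section independence.
Context {R : realType} {disp : measure_display} {T : measurableType disp}.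
Variable P : probability T R.
Local Open Scope ereal_scope.

Lemma mutually_independent_seq {I : choiceType} (A : set I) (F : I -> set_system T) :
  mutually_independent P A F ->
  forall (s : seq I) (E : I -> set T), uniq s -> (forall i, i \in s -> A i) ->
  (forall i, i \in s -> F i (E i)) ->
  P (\big[setI/setT]_(i <- s) E i) = \prod_(i <- s) P (E i).
Proof.
move=> indep s E us sA sF; pose J := [fset i in s]%fset.
have sJ : perm_eq J s by apply: uniq_perm => // i; rewrite inE.
rewrite -(perm_big _ sJ)/= -bigcap_seq indep//.
- by apply: perm_big.
- by move=> i; rewrite /= inE => /sA.
- by move=> i; rewrite inE => /sF.
Qed.

Lemma independent_family_seq {I : choiceType} (A : set I)
    {d' : measure_display} {T' : measurableType d'} (X : I -> {RV P >-> T'}) :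
  independent_family A X ->
  forall (s : seq I) (B : I -> set T'), uniq s -> (forall i, i \in s -> A i) ->
  (forall i, measurable (B i)) ->
  P (\big[setI/setT]_(i <- s) (X i @^-1` B i)) = \prod_(i <- s) P (X i @^-1` B i).
Proof.
move=> indep s B us sA mB; rewrite (mutually_independent_seq indep us sA)// => i _.
by exists (B i) => //; rewrite setTI.
Qed.

Lemma sigma_of_family_bigsetI {I J : Type} (A : set I)
    {d' : measure_display} {T' : measurableType d'} (X : I -> {RV P >-> T'})
    (s : seq J) (p : pred J) (f : J -> I) (B : J -> set T') :
  (forall j, p j -> A (f j)) -> all p s -> (forall j, measurable (B j)) ->
  sigma_of_family A X (\big[setI/setT]_(j <- s) (X (f j) @^-1` B j)).
Proof.
move=> pA ps mB.
elim: s ps => [_|j s IH /= /andP[pj /IH h]].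
  by rewrite big_nil; exact: (@measurableT _ (g_sigma_algebraType _)).
rewrite big_cons.
apply: (@measurableI _ (g_sigma_algebraType (\bigcup_(i in A) sigma_of (X i)))) h => //.
apply: sub_gen_smallest; exists (f j); first exact: pA.
by exists (B j) => //; rewrite setTI.
Qed.

Lemma integral_law_restr {d' : measure_display} {T' : measurableType d'}
    (X : {RV P >-> T'}) (m : {measure set T' -> \bar R}) (D : set T') :
  measurable D -> has_law X (fun B => m (B `&` D)) ->
  forall f : T' -> \bar R, measurable_fun setT f -> (forall x, 0 <= f x) ->
  \int[distribution P X]_y f y = \int[m]_(y in D) f y.
Proof.
move=> mD XD f mf f0.
rewrite -(setvU D) ge0_integral_setU//=; [|exact: measurableC|by rewrite setvU|]; last first.
  by apply/disj_setPS; rewrite setICl.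
rewrite [X in X + _](eq_measure_integral (@mzero _ T' R)); last first.
  move=> A mA AD; rewrite -[LHS]/(distribution P X A) XD// /mzero (_ : _ `&` _ = set0) ?measure0//.
  by apply/seteqP; split => // x [/AD].
rewrite integral_measure_zero add0e; apply: eq_measure_integral => A mA AD.
by rewrite -[LHS]/(distribution P X A) XD// setIidl.
Qed.

Lemma uniform01_gt (t : R) : (0 <= t <= 1)%R ->
  uniform_prob (@ltr01 R) [set u | (t < u)%R] = (1 - t)%:E.
Proof.
move=> /andP[t0 t1].
have -> : [set u | (t < u)%R] = `]t, +oo[%classic.
  by apply/seteqP; split => u /=; rewrite in_itv/= andbT.
have mt : measurable `]t, +oo[%classic by exact: measurable_itv.
transitivity (\int[uniform_prob (@ltr01 R)]_x (\1_(`]t, +oo[%classic) x)%:E).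
  by rewrite integral_indic// setIT.
rewrite integral_uniform//; last by apply/measurable_EFinP; exact: measurable_indic.
rewrite subr0 invr1 mul1e integral_indic//.
rewrite (_ : _ `&` _ = `]t, 1%R]%classic).
  rewrite -[LHS]/(lebesgue_measure `]t, 1%R]%classic).
  rewrite lebesgue_measure_itv/= lte_fin; case: ltP => [//|h].
  by have -> : t = 1%R by [apply/eqP; rewrite eq_le t1]; rewrite subrr.
apply/seteqP; split => u /=; rewrite !in_itv/= ?andbT.
  by move=> [-> /andP[_ ->]].
by move=> /andP[tu u1]; rewrite tu u1 (le_trans t0 (ltW tu)).
Qed.

End independence.

Section isolated_probability.
Context {R : realType} (d : nat) (g : R -> R).
Hypothesis g_01 : forall x : R, (0 <= x)%R -> (0 <= g x <= 1)%R.
Hypothesis g_noninc : forall x y : R, (0 <= x)%R -> (x <= y)%R -> (g y <= g x)%R.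
Context {disp : measure_display} {Omega : measurableType disp}.
Variable P : probability Omega R.
Variable X : nat -> {RV P >-> d.-tuple R}.
Hypothesis X_law : forall i, has_law (X i)
     (fun B => lebesgue_tuple d (B `&` torus d) / lebesgue_tuple d (torus d))%E.
Hypothesis X_indep : independent_family [set: nat] X.
Variable N : nat -> {RV P >-> nat}.
Variable U : nat -> nat -> {RV P >-> R}.
Hypothesis U_law : forall i j, (i < j)%N -> has_law (U i j) (uniform_prob (@ltr01 R)).
Hypothesis U_indep : independent_family [set ij : nat * nat | (ij.1 < ij.2)%N]
     (fun ij => U ij.1 ij.2).
Hypothesis XNU_indep : mutually_independent P [set: 'I_3] (tnth [tuple
     sigma_of_family [set: nat] X;
     sigma_of_family [set n | (0 < n)%N] N;
     sigma_of_family [set ij : nat * nat | (ij.1 < ij.2)%N]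
       (fun ij => U ij.1 ij.2)]).
Local Open Scope ereal_scope.

Local Notation mark i j := (U (minn i j) (maxn i j)).

Lemma has_law_torus i : has_law (X i) (fun B => lebesgue_tuple d (B `&` torus d)).
Proof. by move=> B mB; rewrite X_law// lebesgue_torus inve1 mule1. Qed.

Lemma measurable_torus : measurable (@torus R d).
Proof. by rewrite torus_cube; exact: measurable_cube. Qed.

Lemma minn_ltn_maxn i k : k != i -> (minn i k < maxn i k)%N.
Proof. by case: (ltngtP i k) => // ->; rewrite eqxx. Qed.

(** The three families are independent of each other, and each of them is an
    independent family.  The mark of the pair of [i] and [k] is stored at
    [(minn i k, maxn i k)], so distinct [k] use distinct marks. *)
Lemma independence_rectangles n i m (B : set (d.-tuple R)) (C : nat -> set (d.-tuple R))
    (D : nat -> set R) (K : seq nat) : (0 < n)%N ->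
  measurable B -> (forall k, measurable (C k)) -> (forall k, measurable (D k)) ->
  uniq K -> all (fun k => k != i) K ->
  P (N n @^-1` [set m] `&` (X i @^-1` B `&`
      \big[setI/setT]_(k <- K) (X k @^-1` C k `&` mark i k @^-1` D k))) =
  P (N n @^-1` [set m]) * P (X i @^-1` B) *
  \prod_(k <- K) (P (X k @^-1` C k) * P (mark i k @^-1` D k)).
Proof.
move=> n0 mB mC mD uK iK.
pose C' k := if k == i then B else C k.
have mC' k : measurable (C' k) by rewrite /C'; case: ifP.
have iK' : i \notin K by apply/negP => /(allP iK); rewrite eqxx.
have C'K k : k \in K -> C' k = C k.
  by move=> kK; rewrite /C' ifF//; apply/negbTE/(allP iK).
pose EX := \big[setI/setT]_(k <- i :: K) (X k @^-1` C' k).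
have EXE : EX = X i @^-1` B `&` \big[setI/setT]_(k <- K) (X k @^-1` C k).
  rewrite /EX big_cons {1}/C' eqxx; congr (_ `&` _).
  by apply: eq_big_seq => k /C'K ->.
pose EU := \big[setI/setT]_(k <- K) (mark i k @^-1` D k).
pose E : 'I_3 -> set Omega := tnth [tuple EX; N n @^-1` [set m]; EU].
have -> : N n @^-1` [set m] `&` (X i @^-1` B `&`
      \big[setI/setT]_(k <- K) (X k @^-1` C k `&` mark i k @^-1` D k)) =
    \big[setI/setT]_(t <- index_enum 'I_3) E t.
  rewrite -[RHS]/(\big[setI/setT]_(t : 'I_3) E t).
  rewrite !big_ord_recl big_ord0 /E !(tnth_nth set0)/= setIT EXE big_split /=.
  by apply/seteqP; split => w; rewrite /setI /mkset; tauto.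
rewrite (mutually_independent_seq XNU_indep)//; last 2 first.
- exact: index_enum_uniq.
- move=> t _; case: t => -[|[|[|//]]] t3; rewrite /E !(tnth_nth set0)/=.
  + apply: (@sigma_of_family_bigsetI _ _ _ _ _ _ _ _ _ X (i :: K) predT id) => //.
    exact: all_predT.
  + apply: sub_gen_smallest; exists n => //.
    by exists [set m] => //; rewrite setTI.
  + apply: (@sigma_of_family_bigsetI _ _ _ _ _ _ _ _ _ (fun ij => U ij.1 ij.2) K
      (fun k => k != i) (fun k => (minn i k, maxn i k))) => // k.
    exact: minn_ltn_maxn.
rewrite -[LHS]/(\prod_(t : 'I_3) P (E t)) !big_ord_recl big_ord0 mule1.
rewrite /E !(tnth_nth set0)/= /EX /EU.
rewrite (independent_family_seq X_indep)//; last by rewrite /= iK'.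
(* Recovers [k] from the pair at which the mark of [i] and [k] is stored. *)
pose inv (ij : nat * nat) : nat := if ij.1 == i then ij.2 else ij.1.
have invK k : k != i -> inv (minn i k, maxn i k) = k.
  rewrite /inv /=; case: (ltngtP i k) => [ik|ki|->] _; rewrite ?eqxx//.
  by case: eqP ki => // ->; rewrite ltnn.
have -> : \big[setI/setT]_(k <- K) (mark i k @^-1` D k) =
    \big[setI/setT]_(ij <- [seq (minn i k, maxn i k) | k <- K])
      (U ij.1 ij.2 @^-1` D (inv ij)).
  by rewrite big_map; apply: eq_big_seq => k /(allP iK) /invK ->.
rewrite (independent_family_seq U_indep)//; last 2 first.
- rewrite map_inj_in_uniq// => k k' /(allP iK) ki /(allP iK) k'i kk'.
  by rewrite -(invK k ki) -(invK k' k'i) kk'.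
- by move=> _ /mapP[k /(allP iK) ki ->] /=; exact: minn_ltn_maxn.
rewrite big_map big_cons big_split/= {1}/C' eqxx.
rewrite [\prod_(k <- K) P (X k @^-1` C' k)](eq_big_seq (fun k => P (X k @^-1` C k))); last first.
  by move=> k /C'K ->.
rewrite [\prod_(k <- K) P (mark i k @^-1` D (inv _))](eq_big_seq (fun k => P (mark i k @^-1` D k))); last first.
  by move=> k /(allP iK) /invK ->.
by rewrite -!muleA [in RHS]muleCA; congr (_ * _); rewrite !muleA; congr (_ * _); rewrite muleC.
Qed.

Lemma poisson_law_eq n m : (0 < n)%N -> has_law (N n) (poisson_prob n%:R 0) ->
  P (N n @^-1` [set m]) = (poisson_pmf n%:R m : R)%:E.
Proof.
move=> n0 Nn; rewrite -[LHS]/(distribution P (N n) [set m]) Nn//.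
by rewrite /poisson_prob ltr0n n0 esum_set1// lee_fin poisson_pmf_ge0.
Qed.

Definition unlinked r i j : set Omega :=
  [set w | (g (torus_dist (X i w) (X j w) / r) < mark i j w)%R].

Lemma measurable_link (r : R) : (0 < r)%R ->
  measurable_fun setT (fun p : d.-tuple R * d.-tuple R => g (torus_dist p.1 p.2 / r)).
Proof.
move=> r0; apply: (measurable_comp_nonincreasing g_noninc).
  by move=> p; rewrite divr_ge0 ?torus_dist_ge0// ltW.
by apply: measurable_funM => //; exact: measurable_torus_dist.
Qed.

Lemma measurable_scaled_norm (r : R) : (0 < r)%R ->
  measurable_fun setT (fun y : d.-tuple R => g (euclid_norm y / r)).
Proof.
move=> r0; apply: (measurable_comp_nonincreasing g_noninc).
  by move=> p; rewrite divr_ge0 ?euclid_norm_ge0// ltW.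
by apply: measurable_funM => //; exact: measurable_euclid_norm.
Qed.

Lemma measurable_unlinked r i j : (0 < r)%R -> measurable (unlinked r i j).
Proof.
move=> r0; rewrite -[X in measurable X]setTI.
apply: (measurable_fun_ltr _ _ measurableT (Y := [set true])) => //.
apply: (@measurableT_comp _ _ _ _ _ _ (fun p => g (torus_dist p.1 p.2 / r)) setT
  (fun w => (X i w, X j w)) (measurable_link r0)).
exact: measurable_fun_pair.
Qed.

Lemma edge_prob_bounds (r q : R) : (0 < r)%R ->
  \int[lebesgue_tuple d]_(y in @torus R d) (g (euclid_norm y / r))%:E = q%:E ->
  (0 <= q <= 1)%R.
Proof.
move=> r0 qE; rewrite -!lee_fin -qE; apply/andP; split.
  apply: integral_ge0 => y _; rewrite lee_fin (g_ge0 g_01)//.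
  by rewrite divr_ge0 ?euclid_norm_ge0// ltW.
apply: (@le_trans _ _ (\int[lebesgue_tuple d]_(y in @torus R d) cst 1 y)).
  apply: ge0_le_integral => //.
  - exact: measurable_torus.
  - move=> y _; rewrite lee_fin (g_ge0 g_01)//.
    by rewrite divr_ge0 ?euclid_norm_ge0// ltW.
  - by apply: measurable_funTS; apply/measurable_EFinP; exact: measurable_scaled_norm.
  - move=> y _; rewrite lee_fin.
    by have /andP[] := g_01 (divr_ge0 (euclid_norm_ge0 y) (ltW r0)).
rewrite integral_cst ?mul1e; last exact: measurable_torus.
by rewrite -[leLHS]/(lebesgue_tuple d (torus d)) lebesgue_torus.
Qed.

(** By [integral_torus_dist] a uniform vertex is joined to [x] with the same
    probability [q] as to the origin; this is the complementary probability. *)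
Lemma integral_no_edge (r q : R) (x : d.-tuple R) i : (0 < r)%R ->
  \int[lebesgue_tuple d]_(y in @torus R d) (g (euclid_norm y / r))%:E = q%:E ->
  \int[distribution P (X i)]_y (1 - g (torus_dist x y / r))%:E = (1 - q)%:E.
Proof.
move=> r0 qE.
have td0 y : (0 <= torus_dist x y / r)%R by rewrite divr_ge0 ?torus_dist_ge0// ltW.
have mlink : measurable_fun setT (fun y => g (torus_dist x y / r)).
  exact: (measurableT_comp (measurable_link r0) (pair1_measurable x)).
have gE : \int[distribution P (X i)]_y (g (torus_dist x y / r))%:E = q%:E.
  rewrite (integral_law_restr measurable_torus (@has_law_torus i)).
  - pose f t := (g (Num.max 0%R t / r))%:E.
    have mf : measurable_fun setT f.
      apply/measurable_EFinP; apply: (measurable_comp_nonincreasing g_noninc).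
        by move=> t; rewrite divr_ge0 ?le_max ?lexx// ltW.
      by apply: measurable_funM => //; apply: measurable_maxr.
    have f0 t : 0 <= f t.
      by rewrite lee_fin (g_ge0 g_01)// divr_ge0 ?le_max ?lexx// ltW.
    rewrite -qE (eq_integral (fun y => f (torus_dist x y))); last first.
      by move=> y _; rewrite /f max_r// torus_dist_ge0.
    rewrite integral_torus_dist//; apply: eq_integral => y _.
    by rewrite /f max_r// euclid_norm_ge0.
  - exact/measurable_EFinP.
  - by move=> y; rewrite lee_fin (g_ge0 g_01).
have : \int[distribution P (X i)]_y ((1 - g (torus_dist x y / r))%:E +
    (g (torus_dist x y / r))%:E) = 1.
  under eq_integral do rewrite -EFinD subrK.
  rewrite (integral_cst _ measurableT) mul1e.
  exact: (@probability_setT _ _ _ (distribution P (X i))).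
rewrite ge0_integralD//; last 4 first.
- by move=> y _; rewrite lee_fin subr_ge0; have /andP[] := g_01 (td0 y).
- by apply/measurable_EFinP; apply: measurable_funB.
- by move=> y _; rewrite lee_fin (g_ge0 g_01).
- exact/measurable_EFinP.
rewrite gE => h; rewrite EFinB -h addeK//.
Qed.

(** Isolation of [i] is a star constraint centered at [X i], with [J] the other
    indices and the event [N n = m] carried along as [E0]. *)
Lemma prob_all_unlinked n m i (r q : R) J : (0 < n)%N -> (0 < r)%R ->
  has_law (N n) (poisson_prob n%:R 0) ->
  \int[lebesgue_tuple d]_(y in @torus R d) (g (euclid_norm y / r))%:E = q%:E ->
  uniq J -> all (fun j => j != i) J ->
  P (N n @^-1` [set m] `&` \big[setI/setT]_(j <- J) unlinked r i j) =
  (poisson_pmf n%:R m * (1 - q) ^+ size J)%:E.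
Proof.
move=> n0 r0 Nn qE uJ iJ.
have /andP[q0 q1] := edge_prob_bounds r0 qE.
have s0 : (0 <= 1 - q)%R by rewrite subr_ge0.
pose G : set (d.-tuple R * (d.-tuple R * R)) :=
  [set p | (g (torus_dist p.1 p.2.1 / r) < p.2.2)%R].
have mG : measurable G.
  rewrite -[X in measurable X]setTI.
  apply: (measurable_fun_ltr _ _ measurableT (Y := [set true])) => //.
    apply: (@measurableT_comp _ _ _ _ _ _ (fun p => g (torus_dist p.1 p.2 / r)) setT
      (fun p : d.-tuple R * (d.-tuple R * R) => (p.1, p.2.1)) (measurable_link r0)).
    apply: measurable_fun_pair; first exact: measurable_fst.
    exact: (measurableT_comp measurable_fst measurable_snd).
  exact: (measurableT_comp measurable_snd measurable_snd).
apply: (@measure_star_constraints _ _ _ _ _ _ _ _ _ P (distribution P (X i)) (distribution P (X 0%N))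
   (uniform_prob (@ltr01 R)) (NngNum (poisson_pmf_ge0 n%:R m)) (NngNum s0)
   (N n @^-1` [set m]) (fun j => j != i) (X i) X (fun k => mark i k) G) => //=.
- exact: measurable_preimage.
- by move=> k; exact: (@measurable_funPT _ _ _ _ (mark i k)).
- move=> x; rewrite -(integral_no_edge x 0 r0 qE) /product_measure1.
  apply: eq_integral => y _.
  rewrite -uniform01_gt; last by apply: g_01; rewrite divr_ge0 ?torus_dist_ge0// ltW.
  rewrite /=; congr (uniform_prob _ _).
  by apply/seteqP; split => u h; [exact: (set_mem (set_mem h))|apply: mem_set; exact: mem_set].
- move=> B C D K mB mC mD uK iK.
  rewrite (independence_rectangles _ n0)// poisson_law_eq//; congr (_ * _).
  apply: eq_big_seq => k /(allP iK) ki; congr (_ * _).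
    by rewrite -[LHS]/(distribution P (X k) (C k)) -[RHS]/(distribution P (X 0%N) (C k)) !has_law_torus.
  rewrite -[LHS]/(distribution P (mark i k) (D k)) U_law//.
    exact: minn_ltn_maxn.
  exact: mD.
Qed.

(** * The expected number of isolated nodes *)

Definition others m i : seq nat := [seq j <- iota 0 m | j != i].

Lemma size_others m i : (i < m)%N -> size (others m i) = m.-1.
Proof.
move=> im; rewrite /others -rem_filter ?iota_uniq// size_rem ?size_iota//.
by rewrite mem_iota.
Qed.

Lemma no_neighbour_unlinked r w m (i : 'I_m) :
  (#|[pred j : 'I_m | edge g X U r w i j]| == 0%N) =
  (w \in \big[setI/setT]_(j <- others m i) unlinked r i j).
Proof.
have edgeE j : edge g X U r w i j = (i != j :> nat) && (w \notin unlinked r i j).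
  have -> : (w \notin unlinked r i j) = (mark i j w <= g (torus_dist (X i w) (X j w) / r))%R.
    by rewrite leNgt; congr (~~ _); apply/idP/idP; rewrite inE.
  rewrite /edge /connected; case: (ltngtP i j) => //= _; first by rewrite orbF.
  by rewrite torus_distC.
rewrite -bigcap_seq; apply/eqP/idP.
  move=> /card0_eq h; rewrite inE => j /=; rewrite mem_filter mem_iota add0n => /andP[ji jm].
  have := h (Ordinal jm); rewrite !inE edgeE/= eq_sym ji/= => /negbT.
  by rewrite negbK inE.
rewrite inE => h; apply: eq_card0 => j; rewrite !inE edgeE; apply/negbTE/negP.
move=> /andP[ij /negP]; apply; rewrite inE; apply: h => /=.
by rewrite mem_filter mem_iota eq_sym ij /=.
Qed.

Definition isolated_event n r m i : set Omega :=
  N n @^-1` [set m] `&` \big[setI/setT]_(j <- others m i) unlinked r i j.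

(** Only the term [m = N n w] of the series is nonzero. *)
Lemma isolated_nodesE n r w :
  (isolated_nodes g X U (N n) r w)%:R%:E =
  \sum_(0 <= m <oo) \sum_(i < m) (\1_(isolated_event n r m i) w)%:E :> \bar R.
Proof.
rewrite (nneseriesD1 (n := N n w))//; last first.
  by move=> m _; apply: sume_ge0 => i _; rewrite lee_fin.
rewrite [X in _ + X]eseries0 ?adde0; last first.
  move=> m _ /= mN; rewrite big1// => i _; rewrite indicE memNset//.
  by move=> [/= Nm _]; rewrite Nm eqxx in mN.
rewrite /isolated_nodes -sum1_card natr_sum/= big_mkcond/= -sumEFin.
apply: eq_bigr => i _; congr EFin; rewrite inE no_neighbour_unlinked indicE.
rewrite /isolated_event in_setI (_ : w \in N n @^-1` _) /=; last by rewrite inE.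
by case: (w \in _).
Qed.

(** The factor [m] cancels against the factorial and shifts the exponential
    series by one, leaving [n * expR (- n) * expR (n * s)]. *)
Lemma eseries_poisson n (s : R) : (0 < n)%N ->
  \sum_(0 <= m <oo) (m%:R * (poisson_pmf n%:R m * s ^+ m.-1))%:E =
  (n%:R * expR (- (n%:R * (1 - s))))%:E.
Proof.
move=> n0; apply/cvg_lim => //; rewrite -cvg_shiftS.
pose k : R := (n%:R * expR (- n%:R))%R.
rewrite (_ : (fun M => _) = (fun M => (k * series (exp_coeff (n%:R * s)%R) M)%:E)); last first.
  apply/funext => M; rewrite big_nat_recl//= mul0r add0e sumEFin; congr EFin.
  rewrite /series/= mulr_sumr; apply: eq_bigr => j _.
  rewrite /poisson_pmf ltr0n n0 /exp_coeff /k factS natrM /= exprS exprMn; field.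
  by rewrite nat1r !pnatr_eq0/= -lt0n fact_gt0.
have -> : (n%:R * expR (- (n%:R * (1 - s))) = k * expR (n%:R * s))%R.
  by rewrite /k -mulrA -expRD; congr (_ * expR _)%R; ring.
apply: cvg_EFin; first exact: nearW.
by apply: cvgMl_tmp; exact: is_cvg_series_exp_coeff.
Qed.

(** The vertices contribute equally: given [N n = m], each of the [m] indices is
    isolated with the same probability, and the integral of the series in
    [isolated_nodesE] is taken term by term. *)
Lemma expectation_isolated n (r q : R) : (0 < n)%N -> (0 < r)%R ->
  has_law (N n) (poisson_prob n%:R 0) ->
  \int[lebesgue_tuple d]_(y in @torus R d) (g (euclid_norm y / r))%:E = q%:E ->
  'E_P[(fun w => (isolated_nodes g X U (N n) r w)%:R)] =
  (n%:R * expR (- (n%:R * q)))%:E.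
Proof.
move=> n0 r0 Nn qE.
have mev m i : measurable (isolated_event n r m i).
  apply: measurableI; first exact: measurable_preimage.
  by apply: measurable_bigsetI => j; exact: measurable_unlinked.
rewrite unlock; under eq_integral do rewrite isolated_nodesE.
rewrite integral_nneseries//; last 2 first.
- move=> m; apply: emeasurable_sum => i.
  by apply/measurable_EFinP; exact: measurable_indic.
- by move=> m w _; apply: sume_ge0 => i _; rewrite lee_fin.
rewrite (_ : q = 1 - (1 - q))%R; last by ring.
rewrite -eseries_poisson//; apply: eq_eseriesr => m _.
rewrite ge0_integral_sum//; last first.
  by move=> i; apply/measurable_EFinP; exact: measurable_indic.
rewrite (eq_bigr (fun=> (poisson_pmf n%:R m * (1 - q) ^+ m.-1)%:E)); last first.
  move=> i _; rewrite integral_indic// setIT.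
  rewrite -[LHS]/(P (isolated_event n r m i)).
  rewrite (@prob_all_unlinked n m i r q)// ?size_others//.
    by rewrite filter_uniq// iota_uniq.
  by apply/allP => j; rewrite mem_filter => /andP[].
by rewrite sumEFin sumr_const card_ord mulr_natl.
Qed.

End isolated_probability.

(** * The limit *)

Theorem proposition1p1 (R : realType) (d : nat) (d_ge2 : (2 <= d)%N)
  (* only the values of g on [0, +oo[ matter *)
  (g : R -> R)
  (g_01 : forall x : R, 0 <= x -> 0 <= g x <= 1)
  (g_noninc : forall x y : R, 0 <= x -> x <= y -> g y <= g x)
  (alpha : R) (alpha_gt0 : 0 < alpha)
  (alphaE : (\int[lebesgue_tuple d]_x (g (euclid_norm x))%:E = alpha%:E)%E)
  (disp : measure_display) (Omega : measurableType disp)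
  (P : probability Omega R)
  (X : nat -> {RV P >-> d.-tuple R})
  (X_law : forall i, has_law (X i)
     (fun B => lebesgue_tuple d (B `&` torus d) / lebesgue_tuple d (torus d))%E)
  (X_indep : independent_family [set: nat] X)
  (N : nat -> {RV P >-> nat})
  (* the second argument of poisson_prob is a dummy *)
  (N_law : forall n, (0 < n)%N -> has_law (N n) (poisson_prob n%:R 0))
  (N_nondec : forall m n, (0 < m)%N -> (m <= n)%N ->
     forall w, (N m w <= N n w)%N)
  (U : nat -> nat -> {RV P >-> R})
  (U_law : forall i j, (i < j)%N -> has_law (U i j) (uniform_prob (@ltr01 R)))
  (U_indep : independent_family [set ij : nat * nat | (ij.1 < ij.2)%N]
     (fun ij => U ij.1 ij.2))
  (XNU_indep : mutually_independent P [set: 'I_3] (tnth [tuple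
     sigma_of_family [set: nat] X;
     sigma_of_family [set n | (0 < n)%N] N;
     sigma_of_family [set ij : nat * nat | (ij.1 < ij.2)%N]
       (fun ij => U ij.1 ij.2)]))
  (c : R) (c_gtd : d%:R < c)
  (g_decay : g =o_ (pinfty_nbhs R) (fun x : R => x `^ (- c)))
  (b : R) (r : nat -> R)
  (rE : forall n, (0 < n)%N -> 0 < (ln n%:R + b) / (alpha * n%:R) ->
     0 < r n /\ r n ^+ d = (ln n%:R + b) / (alpha * n%:R)) :
  ('E_P [ (fun w => (isolated_nodes g X U (N n) (r n) w)%:R) ])%E
    @[n --> \oo] --> (expR (- b))%:E.
Proof.
have [C [M [C0 M0 mass]]] := connection_mass_bounds g_01 g_noninc alphaE c_gtd g_decay.
apply: (cvg_isolated_limit _ alpha_gt0 c_gtd C0 M0 rE) => [|n n0 rn0 Mr].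
  exact: leq_trans d_ge2.
have [q [qE q_lower q_upper]] := mass (r n) rn0 Mr.
exists q; split => //.
exact: (expectation_isolated g_01 g_noninc X_law X_indep U_law U_indep XNU_indep
  n0 rn0 (N_law n n0) qE).
Qed.
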